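(* Let $\alpha\vDash n$ be a composition. Then $$\tilde P_\alpha\;\cong\;\bigoplus_{P}\,(HClP_{P})^{\oplus 2^{l_P}},\qquad l_P:=\Big\lfloor\tfrac{|P|+1}{2}\Big\rfloor,$$ where the sum is over all peak sets $P$ in $[n]$ with $P\subseteq D(\alpha)\triangle(D(\alpha)+1)$.
   Context: $\mathbb K$ is an algebraically closed field of characteristic $0$. For a composition $\alpha=(\alpha_1,\dots,\alpha_r)\vDash n$, $D(\alpha)=\{\alpha_1,\alpha_1+\alpha_2,\dots,\alpha_1+\cdots+\alpha_{r-1}\}\subseteq[n-1]$. For a set $D$, $D+1=\{x+1:x\in D\}$ and $\triangle$ is symmetric difference. A peak set in $[n]$ is $P\subseteq\{2,\dots,n-1\}$ with $i\in P\Rightarrow i-1\notin P$; every peak set in $[n]$ is of the form $P(\beta)=\{x\in[2,n-1]:x-1\notin D(\beta),\,x\in D(\beta)\}$ for some $\beta\vDash n$. The 0-Hecke algebra $\mathcal H_n$ is generated by $T_1,\dots,T_{n-1}$ with $T_i^2=-T_i$, $T_iT_j=T_jT_i$ for $|i-j|>1$, $T_iT_{i+1}T_i=T_{i+1}T_iT_{i+1}$. The 0-Hecke-Clifford superalgebra $\mathcal{HC}_n$ is generated by even $T_1,\dots,T_{n-1}$ satisfying these relations and odd $c_1,\dots,c_n$ with $c_i^2=-1$, $c_ic_j=-c_jc_i$ ($i\ne j$), $T_ic_j=c_jT_i$ ($j\neq i,i+1$), $T_ic_i=c_{i+1}T_i$, $(T_i+1)c_{i+1}=c_i(T_i+1)$.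 For $\alpha\vDash n$, $S_\alpha=\mathbb K\eta_\alpha$ is the simple $\mathcal H_n$-module with $T_i\eta_\alpha=-\eta_\alpha$ if $i\in D(\alpha)$ and $0$ otherwise; $P_\alpha$ is its projective cover; $\tilde S_\alpha=\mathrm{Ind}_{\mathcal H_n}^{\mathcal{HC}_n}S_\alpha$ and $\tilde P_\alpha=\mathrm{Ind}_{\mathcal H_n}^{\mathcal{HC}_n}P_\alpha=\mathcal{HC}_n\otimes_{\mathcal H_n}P_\alpha$. It is known (Bergeron–Hivert–Thibon) that the simple $\mathcal{HC}_n$-supermodules, up to isomorphism (not necessarily even), are indexed by peak sets in $[n]$: $HClS_P$ is the simple supermodule such that $\tilde S_\beta\cong HClS_P^{\oplus 2^{\lfloor(|P|+1)/2\rfloor}}$ for every $\beta\vDash n$ with $P(\beta)=P$. $HClP_P$ denotes the projective cover of $HClS_P$ in the category of finitely generated $\mathcal{HC}_n$-supermodules. Isomorphisms of direct sums are understood summand-wise up to the parity change functor $\Pi$ (i.e. $M$ and $\Pi M$ are identified). *)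

(* Defs.v *)
From HB Require Import structures.
From mathcomp Require Import all_boot all_order all_algebra.
From mathcomp Require Import boolp.
Set Implicit Arguments.
Unset Strict Implicit.
Unset Printing Implicit Defensive.
Import GRing.Theory.
Local Open Scope ring_scope.
Local Open Scope quotient_scope.

(* Rings are [pzRingType]s and modules are [lmodType]s.  A K-algebra is a ring
   B together with a ring morphism K -> B whose image is central.

   An algebra given by generators and relations.  [rels B v] says that the
   elements [v g] of the ring B satisfy the relations.  A noncommutative
   polynomial is a list of terms [(k, w)], standing for the sum of the k.w.
   Two polynomials are congruent modulo the ideal generated by the relations
   iff they take equal values in every K-algebra where the relations hold. *)
Section Presentation.
Variables (K : fieldType) (G : choiceType).
Variable rels : forall B : pzRingType, (G -> B) -> Prop.

Definition ncpoly := seq (K * seq G).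

Definition nceval (B : pzRingType) (f : K -> B) (v : G -> B) (p : ncpoly) : B :=
  \sum_(t <- p) f t.1 * \prod_(g <- t.2) v g.

Record interp (B : pzRingType) := Interp {
  iscal : {rmorphism K -> B};
  igen : G -> B;
  iscalC : forall k b, iscal k * b = b * iscal k;
  igenP : rels igen }.

Definition ipeval B (m : interp B) := nceval (iscal m) (igen m).

Definition nceq : rel ncpoly := fun p q =>
  `[< forall B (m : interp B), ipeval m p = ipeval m q >].

Lemma nceq_refl : reflexive nceq. Proof. by move=> p; apply/asboolP. Qed.
Lemma nceq_sym : symmetric nceq.
Proof. by move=> p q; apply/asboolP/asboolP => e B m; rewrite e. Qed.
Lemma nceq_trans : transitive nceq.
Proof.
move=> q p r /asboolP e1 /asboolP e2; apply/asboolP => B m.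
by rewrite e1 e2.
Qed.
Canonical nceq_equiv := EquivRel nceq nceq_refl nceq_sym nceq_trans.

Definition presented := {eq_quot nceq}.
HB.instance Definition _ := Choice.on presented.
Implicit Types x y z : presented.

Definition peval B (m : interp B) x := ipeval m (repr x).

Lemma peval_pi B (m : interp B) p : peval m (\pi_presented p) = ipeval m p.
Proof.
have /eqP : \pi_presented (repr (\pi_presented p)) = \pi_presented p.
  exact: reprK.
by rewrite eqmodE => /asboolP; apply.
Qed.

Lemma presented_ext x y :
  (forall B (m : interp B), peval m x = peval m y) -> x = y.
Proof.
move=> e; rewrite -[x]reprK -[y]reprK; apply/eqP; rewrite eqmodE.
exact/asboolP.
Qed.

Definition ncmul (p q : ncpoly) : ncpoly :=
  [seq (s.1 * t.1, s.2 ++ t.2) | s <- p, t <- q].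
Definition ncopp (p : ncpoly) : ncpoly := [seq (- t.1, t.2) | t <- p].

Definition pscal (k : K) : presented := \pi_presented [:: (k, [::])].
Definition pgen (g : G) : presented := \pi_presented [:: (1, [:: g])].
Definition padd x y : presented := \pi_presented (repr x ++ repr y).
Definition popp x : presented := \pi_presented (ncopp (repr x)).
Definition pmul x y : presented := \pi_presented (ncmul (repr x) (repr y)).

Lemma peval_scal B (m : interp B) k : peval m (pscal k) = iscal m k.
Proof. by rewrite peval_pi /ipeval /nceval big_seq1 /= big_nil mulr1. Qed.
Lemma peval_gen B (m : interp B) g : peval m (pgen g) = igen m g.
Proof.
by rewrite peval_pi /ipeval /nceval big_seq1 /= big_seq1 rmorph1 mul1r.
Qed.
Lemma peval_add B (m : interp B) x y :
  peval m (padd x y) = peval m x + peval m y.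
Proof. by rewrite peval_pi /ipeval /nceval big_cat. Qed.
Lemma peval_opp B (m : interp B) x : peval m (popp x) = - peval m x.
Proof.
rewrite peval_pi /peval /ipeval /nceval big_map /= -sumrN.
by apply: eq_bigr => t _; rewrite rmorphN mulNr.
Qed.
Lemma peval_mul B (m : interp B) x y :
  peval m (pmul x y) = peval m x * peval m y.
Proof.
rewrite peval_pi /peval /ipeval /nceval big_allpairs_dep mulr_suml.
apply: eq_bigr => s _; rewrite mulr_sumr; apply: eq_bigr => t _ /=.
rewrite rmorphM big_cat /= !mulrA; congr (_ * _); rewrite -!mulrA.
by congr (_ * _); exact: iscalC.
Qed.
Definition pevalE := (peval_scal, peval_gen, peval_add, peval_opp, peval_mul).

Fact paddA : associative padd.
Proof. by move=> x y z; apply: presented_ext => B m; rewrite !pevalE addrA. Qed.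
Fact paddC : commutative padd.
Proof. by move=> x y; apply: presented_ext => B m; rewrite !pevalE addrC. Qed.
Fact padd0 : left_id (pscal 0) padd.
Proof.
by move=> x; apply: presented_ext => B m; rewrite !pevalE rmorph0 add0r.
Qed.
Fact paddN : left_inverse (pscal 0) popp padd.
Proof.
by move=> x; apply: presented_ext => B m; rewrite !pevalE rmorph0 addNr.
Qed.
Fact pmulA : associative pmul.
Proof. by move=> x y z; apply: presented_ext => B m; rewrite !pevalE mulrA. Qed.
Fact pmul1 : left_id (pscal 1) pmul.
Proof.
by move=> x; apply: presented_ext => B m; rewrite !pevalE rmorph1 mul1r.
Qed.
Fact pmulr1 : right_id (pscal 1) pmul.
Proof.
by move=> x; apply: presented_ext => B m; rewrite !pevalE rmorph1 mulr1.
Qed.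
Fact pmulDl : left_distributive pmul padd.
Proof.
by move=> x y z; apply: presented_ext => B m; rewrite !pevalE mulrDl.
Qed.
Fact pmulDr : right_distributive pmul padd.
Proof.
by move=> x y z; apply: presented_ext => B m; rewrite !pevalE mulrDr.
Qed.
HB.instance Definition _ := GRing.isPzRing.Build presented
  paddA paddC padd0 paddN pmulA pmul1 pmulr1 pmulDl pmulDr.

Fact pscal_zmod : zmod_morphism pscal.
Proof.
move=> k l; apply: presented_ext => B m.
by rewrite peval_add peval_opp !peval_scal rmorphB.
Qed.
Fact pscal_monoid : monoid_morphism pscal.
Proof.
split=> // k l; apply: presented_ext => B m.
by rewrite peval_mul !peval_scal rmorphM.
Qed.
HB.instance Definition _ := GRing.isZmodMorphism.Build K presented pscal
  pscal_zmod.
HB.instance Definition _ := GRing.isMonoidMorphism.Build K presented pscal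
  pscal_monoid.

Lemma pscal_central k x : pscal k * x = x * pscal k.
Proof.
by apply: presented_ext => B m; rewrite !peval_mul peval_scal iscalC.
Qed.

Fact peval_zmod B (m : interp B) : zmod_morphism (peval m).
Proof. by move=> x y; rewrite peval_add peval_opp. Qed.
Fact peval_monoid B (m : interp B) : monoid_morphism (peval m).
Proof. by split; [rewrite peval_scal rmorph1|exact: peval_mul]. Qed.
HB.instance Definition _ B (m : interp B) :=
  GRing.isZmodMorphism.Build presented B (peval m) (peval_zmod m).
HB.instance Definition _ B (m : interp B) :=
  GRing.isMonoidMorphism.Build presented B (peval m) (peval_monoid m).

(* The Z/2-grading in which a generator g has degree [par g] (true = odd). *)
Variable par : G -> bool.

Definition word_par (w : seq G) : bool := odd (count par w).

Definition pgrade (e : bool) x : Prop :=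
  exists2 p : ncpoly, x = \pi_presented p & all (fun t => word_par t.2 == e) p.

End Presentation.


Definition is_grading (V : zmodType) (gr : bool -> V -> Prop) : Prop :=
  [/\ forall e, gr e 0,
      forall e x y, gr e x -> gr e y -> gr e (x - y),
      forall x, exists x0 x1, [/\ gr false x0, gr true x1 & x = x0 + x1]
    & forall x, gr false x -> gr true x -> x = 0].

Record superring := Superring {
  sr_ring :> pzRingType;
  sr_gr : bool -> sr_ring -> Prop;
  sr_grading : is_grading sr_gr;
  sr_one : sr_gr false 1;
  sr_mul : forall d e a b,
    sr_gr d a -> sr_gr e b -> sr_gr (d (+) e) (a * b) }.

Record supermod (A : superring) := Supermod {
  sm_mod :> lmodType A;
  sm_gr : bool -> sm_mod -> Prop;
  sm_grading : is_grading sm_gr;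
  sm_act : forall d e a x,
    sr_gr d a -> sm_gr e x -> sm_gr (d (+) e) (a *: x) }.

Section GradingTheory.
Variables (V : zmodType) (gr : bool -> V -> Prop) (hgr : is_grading gr).

Lemma gr0 e : gr e 0. Proof. by case: hgr. Qed.
Lemma grB e x y : gr e x -> gr e y -> gr e (x - y).
Proof. by case: hgr => _ + _ _; apply. Qed.
Lemma grN e x : gr e x -> gr e (- x).
Proof. by move=> hx; rewrite -[- x]add0r; apply: grB => //; apply: gr0. Qed.
Lemma grD e x y : gr e x -> gr e y -> gr e (x + y).
Proof. by move=> hx hy; rewrite -[y]opprK; apply: grB => //; apply: grN. Qed.
Lemma gr_disj d e x : gr d x -> gr e x -> d != e -> x = 0.
Proof. by case: hgr => _ _ _ h; case: d; case: e => // ? ? _; apply: h. Qed.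

Lemma gr_decomp x : {p : V * V | [/\ gr false p.1, gr true p.2 & x = p.1 + p.2]}.
Proof.
by apply: cid; case: hgr => _ _ /(_ x) [x0 [x1 h]] _; exists (x0, x1).
Qed.

Definition gproj (e : bool) x : V :=
  if e then (sval (gr_decomp x)).2 else (sval (gr_decomp x)).1.

Lemma gprojP e x : gr e (gproj e x).
Proof. by rewrite /gproj; case: gr_decomp => -[a b] /= []; case: e. Qed.
Lemma gprojE x : x = gproj false x + gproj true x.
Proof. by rewrite /gproj; case: gr_decomp => -[a b] /= []. Qed.
Lemma gproj_uniq x x0 x1 :
  gr false x0 -> gr true x1 -> x = x0 + x1 ->
  forall e, gproj e x = if e then x1 else x0.
Proof.
move=> h0 h1 xE; have e0 : gproj false x - x0 = 0.
  apply: (@gr_disj false true) => //; first by apply: grB => //; apply: gprojP.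
  suff -> : gproj false x - x0 = x1 - gproj true x.
    by apply: grB => //; apply: gprojP.
  by apply/eqP; rewrite subr_eq -addrAC eq_sym subr_eq -gprojE xE addrC.
move=> e; have e1 : gproj false x = x0 by apply/eqP; rewrite -subr_eq0 e0.
case: e => //; apply: (addrI x0); by rewrite -[RHS]xE [RHS]gprojE e1.
Qed.
Lemma gproj_id d e x : gr d x -> gproj e x = if e == d then x else 0.
Proof.
case: d => hx.
  rewrite (@gproj_uniq x 0 x (gr0 _) hx (esym (add0r _))); by case: e.
rewrite (@gproj_uniq x x 0 hx (gr0 _) (esym (addr0 _))); by case: e.
Qed.
Lemma gprojD e : {morph gproj e : x y / x + y}.
Proof.
move=> x y; have := @gproj_uniq (x + y)
  (gproj false x + gproj false y) (gproj true x + gproj true y).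
rewrite addrACA -!gprojE => -> //; try by apply: grD; apply: gprojP.
by case: e.
Qed.

End GradingTheory.

(* [twist b a] is a.g^b in the group ring B[Z/2], realised by 2 x 2 matrices;
   it serves to show that the relations of HC_n are homogeneous. *)
Section Twist.
Variable B : pzRingType.
Definition twist (b : bool) (a : B) : 'M[B]_2 :=
  \matrix_(i, j) (if (i == j) (+) b then a else 0).

Lemma twist_add b : {morph twist b : x y / x + y}.
Proof.
move=> x y; apply/matrixP => i j; rewrite !mxE.
by case: ifP => //; rewrite addr0.
Qed.
Lemma twistN b : {morph twist b : x / - x}.
Proof.
move=> x; apply/matrixP => i j; rewrite !mxE.
by case: ifP => //; rewrite oppr0.
Qed.
Lemma twist0 b : twist b 0 = 0.
Proof. by apply/matrixP => i j; rewrite !mxE if_same. Qed.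
Lemma twist1 : twist false 1 = 1.
Proof. by apply/matrixP => i j; rewrite !mxE addbF; case: eqP. Qed.
Lemma twistM b c x y : twist b x * twist c y = twist (b (+) c) (x * y).
Proof.
apply/matrixP => i j; rewrite !mxE !big_ord_recl big_ord0 !mxE addr0.
case: i => -[|[|i]] //= ?; case: j => -[|[|j]] //= ?;
  by case: b; case: c; rewrite /= ?mulr0 ?mul0r ?addr0 ?add0r.
Qed.
Lemma twist_inj b : injective (twist b).
Proof.
by move=> x y /matrixP /(_ 0 (if b then 1 else 0)); rewrite !mxE; case: b.
Qed.
Lemma twist_disj x y : twist false x = twist true y -> x = 0.
Proof. by move=> /matrixP /(_ 0 0); rewrite !mxE. Qed.
Fact twistF_zmod : zmod_morphism (twist false).
Proof. by move=> x y; rewrite twist_add twistN. Qed.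
Fact twistF_monoid : monoid_morphism (twist false).
Proof. by split; [exact: twist1 | move=> x y; rewrite twistM]. Qed.
HB.instance Definition _ :=
  GRing.isZmodMorphism.Build B 'M[B]_2 (twist false) twistF_zmod.
HB.instance Definition _ :=
  GRing.isMonoidMorphism.Build B 'M[B]_2 (twist false) twistF_monoid.
End Twist.

Section PresentedGrading.
Variables (K : fieldType) (G : choiceType).
Variable rels : forall B : pzRingType, (G -> B) -> Prop.
Variable par : G -> bool.
Arguments rels : clear implicits.
Hypothesis rels_homog : forall (B : pzRingType) (v : G -> B),
  rels B v -> rels 'M[B]_2 (fun g => twist (par g) (v g)).
Notation A := (presented K rels).
Notation gr := (@pgrade K G rels par).

Lemma pgrade_scal k : gr false (pscal rels k).
Proof. by exists [:: (k, [::])]. Qed.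
Lemma pgrade_gen g : gr (par g) (pgen K rels g).
Proof.
exists [:: (1, [:: g])] => //=; by rewrite /word_par /= addn0 oddb eqxx.
Qed.

Lemma pgrade_mul d e (a b : A) : gr d a -> gr e b -> gr (d (+) e) (a * b).
Proof.
move=> [p -> hp] [q -> hq]; exists (ncmul p q).
  apply: presented_ext => B m; rewrite rmorphM /= !peval_pi /ipeval /nceval.
  rewrite big_allpairs_dep mulr_suml; apply: eq_bigr => s _.
  rewrite mulr_sumr; apply: eq_bigr => t _ /=.
  rewrite rmorphM big_cat /= !mulrA; congr (_ * _); rewrite -!mulrA.
  by congr (_ * _); rewrite iscalC.
apply/allP => _ /allpairsP[[s t] /= [sp tq ->]] /=.
have -> : word_par par (s.2 ++ t.2) = word_par par s.2 (+) word_par par t.2.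
  by rewrite /word_par count_cat oddD.
by move/allP: hp => /(_ _ sp)/eqP ->; move/allP: hq => /(_ _ tq)/eqP ->.
Qed.

Lemma twist_central B (m : interp K rels B) k (b : 'M[B]_2) :
  twist false (iscal m k) * b = b * twist false (iscal m k).
Proof.
apply/matrixP => i j; rewrite !mxE.
under eq_bigr do rewrite mxE addbF.
under [RHS]eq_bigr do rewrite mxE addbF.
rewrite (bigD1 i) //= eqxx big1 ?addr0; last first.
  by move=> l; rewrite eq_sym => /negPf ->; rewrite mul0r.
rewrite (bigD1 j) //= eqxx big1 ?addr0 ?iscalC //.
by move=> l /negPf ->; rewrite mulr0.
Qed.

Definition twist_interp B (m : interp K rels B) : interp K rels 'M[B]_2 :=
  @Interp _ _ _ _ (twist (B:=B) false \o iscal m)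
    (fun g => twist (par g) (igen m g)) (twist_central m)
    (rels_homog (igenP m)).

Lemma ipeval_twist B (m : interp K rels B) e (p : ncpoly K G) :
  all (fun t => word_par par t.2 == e) p ->
  ipeval (twist_interp m) p = twist e (ipeval m p).
Proof.
rewrite /ipeval /nceval /=.
elim: p => [|[k w] p IH] /=; first by rewrite !big_nil twist0.
case/andP => /eqP hw hp; rewrite !big_cons IH //= twist_add; congr (_ + _).
suff -> : \prod_(g <- w) twist (par g) (igen m g)
    = twist e (\prod_(g <- w) igen m g) by rewrite twistM.
rewrite -hw {hw}; elim: w => [|g w IHw]; first by rewrite !big_nil twist1.
by rewrite !big_cons IHw twistM /word_par /= oddD oddb.
Qed.

Lemma pgrade_grading : is_grading gr.
Proof.
split.
- move=> e; exists [::] => //; apply: presented_ext => B m.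
  by rewrite rmorph0 /= peval_pi /ipeval /nceval big_nil.
- move=> e _ _ [p -> hp] [q -> hq]; exists (p ++ ncopp q).
    apply: presented_ext => B m; rewrite rmorphB /= !peval_pi.
    rewrite /ipeval /nceval big_cat big_map /= -sumrN; congr (_ + _).
    by apply: eq_bigr => t _; rewrite rmorphN mulNr.
  by rewrite all_cat hp all_map.
- move=> x; pose c (e : bool) := [seq t <- (repr x : ncpoly K G) | word_par par t.2 == e].
  exists (\pi_A (c false)), (\pi_A (c true)); split.
  + by exists (c false) => //; apply: filter_all.
  + by exists (c true) => //; apply: filter_all.
  apply: presented_ext => B m; rewrite rmorphD /= !peval_pi.
  rewrite /peval /ipeval /nceval !big_filter (bigID (fun t => word_par par t.2 == false)) /=.
  by congr (_ + _); apply: eq_bigl => t; case: word_par.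
- move=> _ [p -> hp] [q e hq]; apply: presented_ext => B m.
  rewrite rmorph0 /= peval_pi.
  have := congr1 (peval (twist_interp m)) e.
  by rewrite !peval_pi (ipeval_twist _ hp) (ipeval_twist _ hq) => /twist_disj.
Qed.

Definition presented_superring : superring :=
  Superring pgrade_grading (pgrade_scal 1) pgrade_mul.

End PresentedGrading.

(* Generators are indexed from 0: [T i] is T_{i+1} and [c j] is c_{j+1}. *)
Definition hecke_rels n (B : pzRingType) (T : 'I_n.-1 -> B) : Prop :=
  [/\ forall i, T i * T i = - T i,
      forall i j : 'I_n.-1, (i.+1 < j)%N || (j.+1 < i)%N -> T i * T j = T j * T i
    & forall i j : 'I_n.-1, j = i.+1 :> nat -> T i * T j * T i = T j * T i * T j].

Definition hecke_clifford_rels n (B : pzRingType)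
    (v : 'I_n.-1 + 'I_n -> B) : Prop :=
  let T i := v (inl i) in let c j := v (inr j) in
  hecke_rels T /\
  [/\ forall j, c j * c j = -1,
      forall j k, j != k -> c j * c k = - (c k * c j),
      forall (i : 'I_n.-1) (j : 'I_n), j != i :> nat -> j != i.+1 :> nat ->
        T i * c j = c j * T i,
      forall (i : 'I_n.-1) (j k : 'I_n), j = i :> nat -> k = i.+1 :> nat ->
        T i * c j = c k * T i
    & forall (i : 'I_n.-1) (j k : 'I_n), j = i :> nat -> k = i.+1 :> nat ->
        (T i + 1) * c k = c j * (T i + 1)].

Definition hc_par n (g : 'I_n.-1 + 'I_n) : bool := if g is inr _ then true else false.

Lemma hecke_clifford_homog n (B : pzRingType) (v : 'I_n.-1 + 'I_n -> B) :
  hecke_clifford_rels v ->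
  hecke_clifford_rels (fun g => twist (hc_par g) (v g)).
Proof.
move=> [[h1 h2 h3] [h4 h5 h6 h7 h8]]; split; split => /=.
- by move=> i; rewrite twistM h1 twistN.
- by move=> i j ij; rewrite !twistM h2.
- by move=> i j ij; rewrite !twistM h3.
- by move=> j; rewrite twistM h4 twistN twist1.
- by move=> j k jk; rewrite !twistM -twistN h5.
- by move=> i j ij ij1; rewrite !twistM h6.
- by move=> i j k ji ki; rewrite !twistM (h7 _ _ _ ji ki).
- by move=> i j k ji ki; rewrite -twist1 -twist_add !twistM (h8 _ _ _ ji ki).
Qed.

Definition hecke (K : fieldType) (n : nat) : pzRingType :=
  presented K (@hecke_rels n).

Definition hecke_clifford (K : fieldType) (n : nat) : superring :=
  presented_superring K (@hecke_clifford_homog n).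


Lemma pgen_hecke_clifford K n :
  hecke_clifford_rels (pgen K (@hecke_clifford_rels n)).
Proof.
have E := (rmorphM, rmorphN, rmorphD, rmorph1).
split; split => /=.
- move=> i; apply: presented_ext => B m; rewrite !E /= !peval_gen.
  by case: (igenP m) => -[].
- move=> i j ij; apply: presented_ext => B m; rewrite !E /= !peval_gen.
  by case: (igenP m) => -[_ + _] _; apply.
- move=> i j ij; apply: presented_ext => B m; rewrite !E /= !peval_gen.
  by case: (igenP m) => -[_ _ +] _; apply.
- move=> j; apply: presented_ext => B m; rewrite !E /= !peval_gen.
  by case: (igenP m) => _ [].
- move=> j k jk; apply: presented_ext => B m; rewrite !E /= !peval_gen.
  by case: (igenP m) => _ [_ + _ _ _]; apply.
- move=> i j ij ij1; apply: presented_ext => B m; rewrite !E /= !peval_gen.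
  by case: (igenP m) => _ [_ _ + _ _]; apply.
- move=> i j k ji ki; apply: presented_ext => B m; rewrite !E /= !peval_gen.
  by case: (igenP m) => _ [_ _ _ + _]; apply.
- move=> i j k ji ki; apply: presented_ext => B m; rewrite !E /= !peval_gen.
  by case: (igenP m) => _ [_ _ _ _ +]; apply.
Qed.

Definition hecke_incl_interp K n :
    interp K (@hecke_rels n) (hecke_clifford K n) :=
  @Interp _ _ _ _ (pscal (@hecke_clifford_rels n))
    (fun i => pgen K _ (inl i)) (@pscal_central _ _ _)
    (proj1 (pgen_hecke_clifford K n)).

(* The morphism H_n -> HC_n with T_i |-> T_i. *)
Definition hecke_incl K n : {rmorphism hecke K n -> hecke_clifford K n} :=
  peval (hecke_incl_interp K n).

(* The tensor product of A and M over H, for a ring morphism iota : H -> A.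
   A list [s] of pairs stands for the sum of the a (x) m, for (a, m) in s.
   Two lists are identified iff they have the same image under every balanced
   biadditive map from A x M to an abelian group. *)
Section Tensor.
Variables (H A : pzRingType) (iota : {rmorphism H -> A}) (M : lmodType H).

Definition balanced (V : zmodType) (g : A -> M -> V) : Prop :=
  [/\ forall a b m, g (a + b) m = g a m + g b m,
      forall a m m', g a (m + m') = g a m + g a m'
    & forall a h m, g (a * iota h) m = g a (h *: m)].

Definition tsum (V : zmodType) (g : A -> M -> V) (s : seq (A * M)) : V :=
  \sum_(t <- s) g t.1 t.2.

Definition teq : rel (seq (A * M)) := fun s t =>
  `[< forall (V : zmodType) (g : A -> M -> V),
      balanced g -> tsum g s = tsum g t >].

Lemma teq_refl : reflexive teq. Proof. by move=> p; apply/asboolP. Qed.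
Lemma teq_sym : symmetric teq.
Proof.
by move=> p q; apply/asboolP/asboolP => e V g hg; rewrite (e V g hg).
Qed.
Lemma teq_trans : transitive teq.
Proof.
move=> q p r /asboolP e1 /asboolP e2; apply/asboolP => V g hg.
by rewrite (e1 V g hg) (e2 V g hg).
Qed.
Canonical teq_equiv := EquivRel teq teq_refl teq_sym teq_trans.

Definition tensor := {eq_quot teq}.
HB.instance Definition _ := Choice.on tensor.
Implicit Types x y z : tensor.

Definition teval (V : zmodType) (g : A -> M -> V) x : V := tsum g (repr x).

Lemma teval_pi (V : zmodType) (g : A -> M -> V) s :
  balanced g -> teval g (\pi_tensor s) = tsum g s.
Proof.
move=> hg; have /eqP : \pi_tensor (repr (\pi_tensor s)) = \pi_tensor s.
  exact: reprK.
by rewrite eqmodE => /asboolP; apply.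
Qed.

Lemma tensor_ext x y :
  (forall (V : zmodType) (g : A -> M -> V), balanced g ->
    teval g x = teval g y) -> x = y.
Proof.
move=> e; rewrite -[x]reprK -[y]reprK; apply/eqP; rewrite eqmodE.
exact/asboolP.
Qed.

Lemma balancedN (V : zmodType) (g : A -> M -> V) a m :
  balanced g -> g (- a) m = - g a m.
Proof.
case=> gD _ _; have g0 : g 0 m = 0.
  by apply: (addrI (g 0 m)); rewrite -gD !addr0.
by apply: (addrI (g a m)); rewrite -gD !subrr.
Qed.

Lemma balancedZ (V : zmodType) (g : A -> M -> V) a :
  balanced g -> balanced (fun b m => g (a * b) m).
Proof.
case=> gD gM gb; split=> [b c m|b m m'|b h m]; first by rewrite mulrDr gD.
  by rewrite gM.
by rewrite mulrA gb.
Qed.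

Definition tpure (a : A) (m : M) : tensor := \pi_tensor [:: (a, m)].
Definition tzero : tensor := \pi_tensor [::].
Definition tadd x y : tensor := \pi_tensor (repr x ++ repr y).
Definition topp x : tensor := \pi_tensor [seq (- t.1, t.2) | t <- repr x].
Definition tscale (a : A) x : tensor :=
  \pi_tensor [seq (a * t.1, t.2) | t <- repr x].

Section Eval.
Variables (V : zmodType) (g : A -> M -> V) (hg : balanced g).
Lemma teval_pure a m : teval g (tpure a m) = g a m.
Proof. by rewrite teval_pi // /tsum big_seq1. Qed.
Lemma teval_zero : teval g tzero = 0.
Proof. by rewrite teval_pi // /tsum big_nil. Qed.
Lemma teval_add x y : teval g (tadd x y) = teval g x + teval g y.
Proof. by rewrite teval_pi // /tsum big_cat. Qed.
Lemma teval_opp x : teval g (topp x) = - teval g x.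
Proof.
rewrite teval_pi // /teval /tsum big_map /= -sumrN.
by apply: eq_bigr => t _; apply: balancedN.
Qed.
Lemma teval_scale a x : teval g (tscale a x) = teval (fun b m => g (a * b) m) x.
Proof. by rewrite teval_pi // /teval /tsum big_map. Qed.
End Eval.

Fact taddA : associative tadd.
Proof. by move=> x y z; apply: tensor_ext => V g h; rewrite !teval_add ?addrA. Qed.
Fact taddC : commutative tadd.
Proof. by move=> x y; apply: tensor_ext => V g h; rewrite !teval_add // addrC. Qed.
Fact tadd0 : left_id tzero tadd.
Proof.
by move=> x; apply: tensor_ext => V g h; rewrite teval_add // teval_zero ?add0r.
Qed.
Fact taddN : left_inverse tzero topp tadd.
Proof.
move=> x; apply: tensor_ext => V g h.
by rewrite teval_add // teval_opp // teval_zero // addNr.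
Qed.
HB.instance Definition _ :=
  GRing.isZmodule.Build tensor taddA taddC tadd0 taddN.

Fact tscaleA a b x : tscale a (tscale b x) = tscale (a * b) x.
Proof.
apply: tensor_ext => V g h; rewrite !teval_scale //; last exact: balancedZ.
by apply: eq_bigr => t _; rewrite mulrA.
Qed.
Fact tscale1 : left_id 1 tscale.
Proof.
move=> x; apply: tensor_ext => V g h; rewrite teval_scale //.
by apply: eq_bigr => t _; rewrite mul1r.
Qed.
Fact tscaleDr : right_distributive tscale +%R.
Proof.
move=> a x y; apply: tensor_ext => V g h.
by rewrite teval_add // !teval_scale // teval_add //; apply: balancedZ.
Qed.
Fact tscaleDl x : {morph tscale^~ x : a b / a + b}.
Proof.
move=> a b; apply: tensor_ext => V g h.
rewrite teval_add // !teval_scale // -big_split /=.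
by apply: eq_bigr => t _; case: h => gD _ _; rewrite mulrDl gD.
Qed.
HB.instance Definition _ := GRing.Zmodule_isLmodule.Build A tensor
  tscaleA tscale1 tscaleDr tscaleDl.

Lemma tpure_balanced : balanced tpure.
Proof.
split=> [a b m|a m m'|a h m]; apply: tensor_ext => V g hg;
  rewrite ?teval_add // !teval_pure //; by case: hg.
Qed.

Lemma tpure_scale a b m : a *: tpure b m = tpure (a * b) m.
Proof.
apply: tensor_ext => V g h; rewrite teval_scale // !teval_pure //.
exact: balancedZ.
Qed.

Lemma tensorE x : x = \sum_(t <- repr x) tpure t.1 t.2.
Proof.
rewrite -[LHS]reprK; elim: (repr x) => [|[a m] s IH]; first by rewrite big_nil.
rewrite big_cons -IH; apply: tensor_ext => V g h.
by rewrite teval_add // teval_pure // !teval_pi // /tsum big_cons.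
Qed.

Fact teval_zmod (V : zmodType) (g : A -> M -> V) :
  balanced g -> zmod_morphism (teval g).
Proof. by move=> h x y; rewrite teval_add // teval_opp. Qed.

End Tensor.

Section InducedSupermodule.
Variables (H : pzRingType) (A : superring) (iota : {rmorphism H -> A}).
Hypothesis iota_even : forall h, sr_gr false (iota h).
Variable M : lmodType H.
Notation N := (tensor iota M).
Notation gA := (sr_grading A).

(* M is purely even, so that a (x) m has the degree of a. *)
Definition ind_gr (e : bool) (x : N) : Prop :=
  exists2 s : seq (A * M), x = \sum_(t <- s) tpure iota t.1 t.2
    & forall t, t \in s -> sr_gr e t.1.

Definition tproj (e : bool) (a : A) (m : M) : N := tpure iota (gproj gA e a) m.

Lemma gproj_iota e a h : gproj gA e (a * iota h) = gproj gA e a * iota h.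
Proof.
rewrite (@gproj_uniq _ _ gA _ (gproj gA false a * iota h)
   (gproj gA true a * iota h)); first by case: e.
- by apply: (@sr_mul A false false) => //; apply: gprojP.
- by apply: (@sr_mul A true false) => //; apply: gprojP.
by rewrite -mulrDl -gprojE.
Qed.

Lemma tproj_balanced e : balanced iota (tproj e).
Proof.
have [gD gM gb] := tpure_balanced iota M.
split=> [a b m|a m m'|a h m]; rewrite /tproj; first by rewrite gprojD gD.
  by rewrite gM.
by rewrite gproj_iota gb.
Qed.

Lemma tproj_gr d e x : ind_gr d x ->
  teval (tproj e) x = if e == d then x else 0.
Proof.
case=> s -> hs.
have h := tproj_balanced e.
rewrite (big_morph (teval (tproj e)) (teval_add h) (teval_zero h)).
have t0 (m : M) : tpure iota 0 m = 0.
  have [gD _ _] := tpure_balanced iota M.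
  by apply: (addrI (tpure iota 0 m)); rewrite -gD !addr0.
have E t : t \in s -> teval (tproj e) (tpure iota t.1 t.2) =
    if e == d then tpure iota t.1 t.2 else 0.
  move=> /hs ht; rewrite teval_pure // /tproj (gproj_id _ _ ht).
  by case: ifP.
rewrite big_seq (eq_bigr _ E) -big_seq; case: ifP => // _.
by rewrite big1.
Qed.

Fact ind_grading : is_grading ind_gr.
Proof.
have [gD _ _] := tpure_balanced iota M.
have tN a m : tpure iota (- a) m = - tpure iota a m :> N.
  exact: (balancedN _ _ (tpure_balanced iota M)).
split.
- by move=> e; exists [::]; rewrite ?big_nil.
- move=> e _ _ [s -> hs] [t -> ht].
  exists (s ++ [seq (- u.1, u.2) | u <- t]).
    rewrite big_cat big_map /= -sumrN; congr (_ + _).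
    by apply: eq_bigr => u _; rewrite tN.
  move=> u; rewrite mem_cat => /orP[/hs//|/mapP[v /ht hv ->]].
  exact: (grN gA hv).
- move=> x; pose c e := [seq (gproj gA e t.1, t.2) | t <- repr x].
  exists (\sum_(t <- c false) tpure iota t.1 t.2),
         (\sum_(t <- c true) tpure iota t.1 t.2); split.
  + by exists (c false) => // _ /mapP[t _ ->]; apply: gprojP.
  + by exists (c true) => // _ /mapP[t _ ->]; apply: gprojP.
  rewrite !big_map -big_split {1}[x]tensorE; apply: eq_bigr => t _ /=.
  by rewrite -gD -gprojE.
- move=> x /(tproj_gr true) /= + /(tproj_gr true) /=.
  by move=> -> .
Qed.

Fact ind_act d e (a : A) (x : N) :
  sr_gr d a -> ind_gr e x -> ind_gr (d (+) e) (a *: x).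
Proof.
move=> ha [s -> hs]; exists [seq (a * t.1, t.2) | t <- s].
  by rewrite big_map scaler_sumr; apply: eq_bigr => t _; rewrite tpure_scale.
by move=> _ /mapP[t /hs ht ->]; apply: sr_mul.
Qed.

Definition ind_supermod : supermod A := Supermod ind_grading ind_act.

End InducedSupermodule.

Lemma hecke_incl_even K n (h : hecke K n) : sr_gr false (hecke_incl K n h).
Proof.
rewrite /hecke_incl /= /peval /ipeval /nceval.
have G := sr_grading (hecke_clifford K n).
elim: (repr h : ncpoly K _) => [|[k w] p IH]; first by rewrite big_nil; apply: gr0.
rewrite big_cons; apply: (grD G) => //.
apply: (@sr_mul (hecke_clifford K n) false false); first exact: pgrade_scal.
elim: w => [|i w IHw]; first by rewrite big_nil; apply: sr_one.
rewrite big_cons; apply: (@sr_mul (hecke_clifford K n) false false) => //.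
exact: (@pgrade_gen K _ _ (@hc_par n) (inl i)).
Qed.

Definition Ind K n (M : lmodType (hecke K n)) : supermod (hecke_clifford K n) :=
  ind_supermod (@hecke_incl_even K n) M.


(* The parity change functor.  The action is left unchanged; twisting it by
   signs, as some authors do, gives an evenly isomorphic supermodule. *)
Section Parity.
Variables (A : superring) (M : supermod A).

Definition parity_gr (e : bool) : M -> Prop := sm_gr (~~ e).

Fact parity_grading : is_grading parity_gr.
Proof.
have [h0 hB hD hI] := sm_grading M; split=> [e|e x y|x|x hx0 hx1].
- exact: h0.
- exact: hB.
- have [x0 [x1 [h0x h1x ->]]] := hD x.
  by exists x1, x0; split => //; rewrite addrC.
- exact: hI hx1 hx0.
Qed.

Fact parity_act d e (a : A) (x : M) :
  sr_gr d a -> parity_gr e x -> parity_gr (d (+) e) (a *: x).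
Proof. by move=> ha hx; rewrite /parity_gr -addbN; apply: sm_act. Qed.

Definition parity : supermod A := Supermod parity_grading parity_act.

End Parity.

Definition parity_if A (b : bool) (M : supermod A) : supermod A :=
  if b then parity M else M.

Section DirectSum.
Variables (A : superring) (I : finType) (M : I -> supermod A).

Definition dsum_car := {dffun forall i : I, M i}.
HB.instance Definition _ := Choice.on dsum_car.
Implicit Types x y : dsum_car.

Definition dsum_zero : dsum_car := [ffun i => 0 : M i].
Definition dsum_opp x : dsum_car := [ffun i => - x i].
Definition dsum_add x y : dsum_car := [ffun i => x i + y i].
Definition dsum_scale (a : A) x : dsum_car := [ffun i => a *: x i].

Fact dsum_addA : associative dsum_add.
Proof. by move=> x y z; apply/ffunP => i; rewrite !ffunE addrA. Qed.
Fact dsum_addC : commutative dsum_add.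
Proof. by move=> x y; apply/ffunP => i; rewrite !ffunE addrC. Qed.
Fact dsum_add0 : left_id dsum_zero dsum_add.
Proof. by move=> x; apply/ffunP => i; rewrite !ffunE add0r. Qed.
Fact dsum_addN : left_inverse dsum_zero dsum_opp dsum_add.
Proof. by move=> x; apply/ffunP => i; rewrite !ffunE addNr. Qed.
HB.instance Definition _ :=
  GRing.isZmodule.Build dsum_car dsum_addA dsum_addC dsum_add0 dsum_addN.

Fact dsum_scaleA a b x : dsum_scale a (dsum_scale b x) = dsum_scale (a * b) x.
Proof. by apply/ffunP => i; rewrite !ffunE scalerA. Qed.
Fact dsum_scale1 : left_id 1 dsum_scale.
Proof. by move=> x; apply/ffunP => i; rewrite !ffunE scale1r. Qed.
Fact dsum_scaleDr : right_distributive dsum_scale +%R.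
Proof. by move=> a x y; apply/ffunP => i; rewrite !ffunE scalerDr. Qed.
Fact dsum_scaleDl x : {morph dsum_scale^~ x : a b / a + b}.
Proof. by move=> a b; apply/ffunP => i; rewrite !ffunE scalerDl. Qed.
HB.instance Definition _ := GRing.Zmodule_isLmodule.Build A dsum_car
  dsum_scaleA dsum_scale1 dsum_scaleDr dsum_scaleDl.

Definition dsum_gr (e : bool) x : Prop := forall i, sm_gr e (x i).

Fact dsum_grading : is_grading dsum_gr.
Proof.
have G i := sm_grading (M i); split.
- by move=> e i; rewrite ffunE; apply: (gr0 (G i)).
- by move=> e x y hx hy i; rewrite !ffunE; apply: (grB (G i)).
- move=> x; exists [ffun i => gproj (G i) false (x i)],
    [ffun i => gproj (G i) true (x i)]; split.
  + by move=> i; rewrite ffunE; apply: gprojP.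
  + by move=> i; rewrite ffunE; apply: gprojP.
  by apply/ffunP => i; rewrite !ffunE -gprojE.
- move=> x h0 h1; apply/ffunP => i; rewrite ffunE.
  exact: (gr_disj (G i) (h0 i) (h1 i)).
Qed.

Fact dsum_act d e (a : A) (x : dsum_car) :
  sr_gr d a -> dsum_gr e x -> dsum_gr (d (+) e) (a *: x).
Proof. by move=> ha hx i; rewrite ffunE; apply: sm_act. Qed.

Definition dsum : supermod A := Supermod dsum_grading dsum_act.

End DirectSum.

Definition surj (X Y : Type) (f : X -> Y) : Prop := forall y, exists x, f x = y.

Definition projective (A : pzRingType) (P : lmodType A) : Prop :=
  forall (M N : lmodType A) (g : {linear M -> N}) (f : {linear P -> N}),
    surj g -> exists h : {linear P -> M}, forall x, g (h x) = f x.

Definition projective_cover (A : pzRingType) (P S : lmodType A) : Prop :=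
  projective P /\
  exists2 f : {linear P -> S}, surj f
    & forall (M : lmodType A) (g : {linear M -> P}), surj (f \o g) -> surj g.

Section SupermoduleCategory.
Variable A : superring.
Implicit Types M N P S : supermod A.

Definition finitely_generated M : Prop :=
  exists (k : nat) (v : 'I_k -> M),
    forall x, exists a : 'I_k -> A, x = \sum_(i < k) a i *: v i.

Definition even_map M N (f : M -> N) : Prop :=
  forall e x, sm_gr e x -> sm_gr e (f x).

Definition superiso M N : Prop :=
  exists2 f : {linear M -> N}, even_map f & bijective f.

(* M is isomorphic to the direct sum of the F i, up to parity change of each
   of the summands. *)
Definition superiso_dsum M (I : finType) (F : I -> supermod A) : Prop :=
  exists e : I -> bool, superiso M (dsum (fun i => parity_if (e i) (F i))).

Definition sub_supermodule M (U : M -> Prop) : Prop :=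
  [/\ U 0, forall x y, U x -> U y -> U (x + y),
      forall a x, U x -> U (a *: x)
    & forall x y, sm_gr false x -> sm_gr true y -> U (x + y) -> U x /\ U y].

Definition super_simple M : Prop :=
  (exists x : M, x != 0) /\
  forall U : M -> Prop, sub_supermodule U ->
    (forall x, U x -> x = 0) \/ (forall x, U x).

Definition super_projective P : Prop :=
  finitely_generated P /\
  forall M N (g : {linear M -> N}) (f : {linear P -> N}),
    finitely_generated M -> finitely_generated N ->
    even_map g -> even_map f -> surj g ->
    exists2 h : {linear P -> M}, even_map h & forall x, g (h x) = f x.

Definition super_projective_cover P S : Prop :=
  super_projective P /\
  exists f : {linear P -> S}, [/\ even_map f, surj f
    & forall M (g : {linear M -> P}), finitely_generated M -> even_map g ->
        surj (f \o g) -> surj g].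

End SupermoduleCategory.

Definition is_comp (n : nat) (alpha : seq nat) : bool :=
  all (ltn 0) alpha && (sumn alpha == n).

Definition descents (alpha : seq nat) : seq nat :=
  [seq sumn (take k alpha) | k <- iota 1 (size alpha).-1].

(* Subsets of [n] are elements of {set 'I_n.+1} not containing 0. *)
Definition is_peak_set n (P : {set 'I_n.+1}) : bool :=
  [forall x in P, (1 < x < n)%N] &&
  [forall x in P, forall y in P, x != y.+1 :> nat].

Definition peaks n (beta : seq nat) : {set 'I_n.+1} :=
  [set x : 'I_n.+1 | [&& (1 < x < n)%N, x.-1 \notin descents beta
                       & nat_of_ord x \in descents beta]].

Definition descents_symdiff n (alpha : seq nat) : {set 'I_n.+1} :=
  let D := descents alpha in
  [set x : 'I_n.+1 | (nat_of_ord x \in D) (+) (nat_of_ord x \in map succn D)].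

Definition peak_exp n (P : {set 'I_n.+1}) : nat := #|P|.+1./2.

Section SimpleHeckeModule.
Variables (K : fieldType) (n : nat) (alpha : seq nat).

Definition hecke_char_gen (i : 'I_n.-1) : K :=
  if i.+1 \in descents alpha then -1 else 0.

Fact hecke_char_rels : hecke_rels hecke_char_gen.
Proof.
split=> [i|i j _|i j _]; rewrite /hecke_char_gen; first 1 last.
- exact: mulrC.
- by do 2!case: ifP => _; rewrite ?(mulr0, mul0r).
by case: ifP => _; rewrite ?mulr0 ?oppr0 // mulN1r.
Qed.

Definition hecke_char_interp : interp K (@hecke_rels n) K :=
  @Interp K _ _ K idfun hecke_char_gen (fun k b => mulrC k b) hecke_char_rels.

Definition hecke_char : {rmorphism hecke K n -> K} := peval hecke_char_interp.

Definition hecke_simple_car : Type := K.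
HB.instance Definition _ := GRing.Zmodule.on hecke_simple_car.

Definition hecke_simple_scale (h : hecke K n) (x : hecke_simple_car) :
  hecke_simple_car := (hecke_char h * x : K).

Fact hecke_simple_scaleA a b x :
  hecke_simple_scale a (hecke_simple_scale b x) = hecke_simple_scale (a * b) x.
Proof. by rewrite /hecke_simple_scale rmorphM mulrA. Qed.
Fact hecke_simple_scale1 : left_id 1 hecke_simple_scale.
Proof. by move=> x; rewrite /hecke_simple_scale rmorph1 mul1r. Qed.
Fact hecke_simple_scaleDr : right_distributive hecke_simple_scale +%R.
Proof. by move=> a x y; apply: mulrDr. Qed.
Fact hecke_simple_scaleDl x :
  {morph hecke_simple_scale^~ x : a b / a + b}.
Proof. by move=> a b; rewrite /hecke_simple_scale rmorphD; apply: mulrDl. Qed.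
HB.instance Definition _ :=
  GRing.Zmodule_isLmodule.Build (hecke K n) hecke_simple_car
    hecke_simple_scaleA hecke_simple_scale1 hecke_simple_scaleDr
    hecke_simple_scaleDl.

(* S_alpha, with eta_alpha = 1 in K. *)
Definition hecke_simple : lmodType (hecke K n) := hecke_simple_car.

Lemma hecke_simpleE (i : 'I_n.-1) (x : hecke_simple) :
  pgen K _ i *: x = if i.+1 \in descents alpha then - x else 0.
Proof.
rewrite /GRing.scale /= /hecke_simple_scale /hecke_char /= peval_gen /=.
by rewrite /hecke_char_gen; case: ifP => _; rewrite ?mulN1r ?mul0r.
Qed.

End SimpleHeckeModule.

(* Main.v *)
From HB Require Import structures.
Require Import Defs.
From mathcomp Require Import all_boot all_order all_algebra.
From mathcomp Require Import boolp.
From mathcomp Require classical_sets.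
From mathcomp Require Import ring zify.
Set Implicit Arguments.
Unset Strict Implicit.
Unset Printing Implicit Defensive.
Import GRing.Theory.
Local Open Scope ring_scope.

(** Write S_P for the supermodule induced from the simple module S_beta with
D(beta) = P, where P is a peak set.  As S_P is a sum of 2^(l_P) copies of
HClS_P up to parity, it suffices to build a surjection with superfluous kernel
from Ind(P_alpha) onto the sum, up to parity, of the S_P for P contained in the
symmetric difference X of D(alpha) and D(alpha)+1; comparing projective covers
then gives the result.

The module S_P has a basis c_E eta, in terms of which T_i is triangular for a
suitable weight on E, with diagonal entries 0 and -1.  Let e be an idempotent
of the 0-Hecke algebra H with P_alpha = H e.  By triangularity, e S_P has for
basis the e c_E eta such that the diagonal character at E is that of S_alpha.
Such E exist iff P is contained in X, and then they differ from a fixed one E0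
by the subsets F such that c_F eta is an eigenvector of the same type as eta.
So an endomorphism of S_P is determined by its value at y = e c_E0 eta, and this
value can be any element of e S_P.  Moreover Hom(S_P, S_Q) = 0 if P <> Q.
Hence the elements y generate the sum of the S_P, and every map from
Ind(P_alpha) to a simple supermodule factors through it. *)

(** * Linear maps, presented algebras and maps out of a tensor product *)

Fact mklin_subproof (R : pzRingType) (U V : lmodType R) (f : U -> V) :
  linear f -> {g : {linear U -> V} | g =1 f}.
Proof.
move=> fL; pose g : {linear U -> V} := HB.pack f (GRing.isLinear.Build R U V *:%R f fL).
by exists g.
Qed.

(** The map sits behind an opaque proof, so that only [mklinE] computes it and unification never
    unfolds it. *)
Definition mklin (R : pzRingType) (U V : lmodType R) (f : U -> V)
  (fL : linear f) : {linear U -> V} := sval (mklin_subproof fL).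

Lemma mklinE (R : pzRingType) (U V : lmodType R) (f : U -> V) (fL : linear f) :
  mklin fL =1 f.
Proof. exact: svalP (mklin_subproof fL). Qed.

Section Presented.
Variables (K : fieldType) (G : choiceType).
Variable rels : forall B : pzRingType, (G -> B) -> Prop.
Arguments rels : clear implicits.
Notation A := (presented K rels).

Lemma presentedE (x : A) : exists p : seq (K * seq G),
  x = \sum_(t <- p) pscal rels t.1 * \prod_(g <- t.2) pgen K rels g.
Proof.
exists (repr x); apply: presented_ext => B m; rewrite rmorph_sum /=.
apply: eq_bigr => t _; rewrite rmorphM rmorph_prod /= peval_scal.
congr (_ * _); apply: eq_bigr => g _.
by rewrite peval_gen.
Qed.

Lemma presented_ind (P : A -> Prop) :
  (forall k, P (pscal rels k)) -> (forall g, P (pgen K rels g)) ->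
  (forall x y, P x -> P y -> P (x + y)) ->
  (forall x y, P x -> P y -> P (x * y)) -> forall x, P x.
Proof.
move=> Pk Pg PD PM x; have [p ->] := presentedE x.
elim: p => [|[k w] p IH]; first by rewrite big_nil -(rmorph0 (pscal rels)); apply: (Pk).
rewrite big_cons; apply: (PD) IH; apply: (PM) => //=.
elim: w => [|g w IH]; first by rewrite big_nil -(rmorph1 (pscal rels)); apply: (Pk).
by rewrite big_cons; apply: PM.
Qed.

End Presented.

Section TensorLift.
Variables (H : pzRingType) (A : superring) (iota : {rmorphism H -> A}).
Hypothesis iota_even : forall h, sr_gr false (iota h).
Variables (M : lmodType H) (Y : lmodType A) (f : M -> Y).
Hypothesis fD : forall x y, f (x + y) = f x + f y.
Hypothesis fZ : forall h x, f (h *: x) = iota h *: f x.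

Fact ind_lift_balanced : balanced iota (fun a m => a *: f m).
Proof.
split=> [a b m|a m m'|a h m]; first exact: scalerDl.
  by rewrite fD scalerDr.
by rewrite fZ scalerA.
Qed.

Fact ind_lift_linear : linear (teval (H:=H) (iota:=iota) (M:=M) (fun a m => a *: f m)).
Proof.
move=> a x y; rewrite teval_add; last exact: ind_lift_balanced.
congr (_ + _); rewrite teval_scale; last exact: ind_lift_balanced.
rewrite /teval /tsum scaler_sumr; apply: eq_bigr => t _.
by rewrite scalerA.
Qed.

(** Frobenius reciprocity. [f] is a bare map with [fD] and [fZ] because [Y] is not given a module
    structure over [H]. *)
Definition ind_lift : {linear ind_supermod iota_even M -> Y} := mklin ind_lift_linear.

Lemma ind_lift_pure a m : ind_lift (tpure iota a m) = a *: f m.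
Proof. by rewrite mklinE teval_pure //; apply: ind_lift_balanced. Qed.

End TensorLift.

Section TensorExt.
Variables (H : pzRingType) (A : superring) (iota : {rmorphism H -> A}).
Hypothesis iota_even : forall h, sr_gr false (iota h).
Variables (M : lmodType H).
Notation N := (ind_supermod iota_even M).

Lemma tensor_lin_ext (Y : lmodType A) (f g : {linear N -> Y}) :
  (forall m, f (tpure iota 1 m : N) = g (tpure iota 1 m : N)) -> f =1 g.
Proof.
move=> fg x; rewrite [x]tensorE !raddf_sum; apply: eq_bigr => -[a m] _ /=.
by rewrite -[a]mulr1 -tpure_scale !linearZ /= fg.
Qed.

Lemma tpureZ h m : tpure iota 1 (h *: m) = iota h *: tpure iota 1 m :> N.
Proof.
rewrite tpure_scale mulr1; have [_ _ gb] := tpure_balanced iota M.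
by rewrite -gb mul1r.
Qed.

Lemma tpure_even m : sm_gr false (tpure iota 1 m : N).
Proof.
exists [:: (1, m)]; first by rewrite big_seq1.
by move=> t; rewrite inE => /eqP ->; apply: sr_one.
Qed.

(** The shift [d] is kept because the images of generators used later, eigenvectors and [witness],
    may be odd. *)
Lemma ind_even (Y : supermod A) (d : bool) (f : {linear N -> Y}) :
  (forall m, sm_gr d (f (tpure iota 1 m : N))) ->
  forall e x, sm_gr e x -> sm_gr (e (+) d) (f x).
Proof.
move=> fd e x [s -> hs]; rewrite raddf_sum.
have Y0 := sm_grading Y.
rewrite big_seq; apply: big_ind => [|y z|[a m] /hs /= ha].
- exact: gr0.
- exact: grD.
by rewrite -[a]mulr1 -tpure_scale linearZ; apply: sm_act.
Qed.

End TensorExt.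

(** * Operators of the Clifford module *)

Section Bits.
Variable n : nat.
Definition bits := {ffun 'I_n -> bool}.
Implicit Types (F : bits) (j k : 'I_n) (x y : bool).

Definition flip x j F : bits := [ffun k => F k (+) (x && (k == j))].

Lemma flipE x j F k : flip x j F k = F k (+) (x && (k == j)).
Proof. by rewrite ffunE. Qed.

Lemma flip0 j F : flip false j F = F.
Proof. by apply/ffunP => k; rewrite flipE addbF. Qed.

Lemma flipD x y j F : flip x j (flip y j F) = flip (x (+) y) j F.
Proof.
apply/ffunP => k; rewrite !flipE -addbA; congr addb.
by case: x; case: y; case: eqP.
Qed.

Lemma flipK x j : involutive (flip x j).
Proof. by move=> F; rewrite flipD addbb flip0. Qed.

Lemma flipC x y j k F : flip x j (flip y k F) = flip y k (flip x j F).
Proof. by apply/ffunP => l; rewrite !flipE addbAC. Qed.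

(* The sign picked up by c_j when it moves past the smaller factors of c_F. *)
Definition sgb j F : bool := \big[addb/false]_(k < n | (k < j)%N) F k.

Lemma sgb_flip x j k F : sgb j (flip x k F) = sgb j F (+) (x && (k < j)%N).
Proof.
rewrite /sgb; under eq_bigr do rewrite flipE.
rewrite big_split /=; congr addb.
case: (ltnP k j) => kj; last first.
  rewrite andbF big1 // => l lj.
  by case: eqP lj => [->|_]; rewrite ?andbF // ltnNge kj.
rewrite (bigD1 k) //= eqxx big1 ?addbF //.
by move=> l /andP[_ /negPf ->]; rewrite andbF.
Qed.

Lemma sgb_next j k F : k = j.+1 :> nat -> sgb k F = sgb j F (+) F j.
Proof.
move=> kj; rewrite /sgb kj (bigD1 j) //= addbC; congr addb.
by apply: eq_bigl => l; rewrite ltnS leq_eqVlt -val_eqE /=; case: ltngtP.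
Qed.
End Bits.

Section CliffordOperators.
Variables (K : fieldType) (n : nat).
Notation bits := (bits n).
(* [f] stands for the sum of the [f F] c_F eta. *)
Definition cspace := {ffun bits -> K^o}.
HB.instance Definition _ := Vector.on cspace.
Implicit Types (f : cspace) (F : bits) (i : 'I_n.-1) (j k : 'I_n).

(** The coefficient at c_F comes from F with j flipped. Besides the sign of passing the smaller
    factors there is c_j^2 = -1 when j is absent from F. *)
Definition cact j f : cspace :=
  [ffun F : bits => (-1) ^+ (sgb j F (+) ~~ F j) * f (flip true j F)].

Lemma cactE j f F :
  cact j f F = (-1) ^+ (sgb j F (+) ~~ F j) * f (flip true j F).
Proof. by rewrite ffunE. Qed.

Fact cact_linear j : linear (cact j).
Proof.
by move=> a f g; apply/ffunP => F; rewrite !ffunE /GRing.scale /=; ring.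
Qed.
HB.instance Definition _ j :=
  GRing.isLinear.Build K cspace cspace _ (cact j) (cact_linear j).

Fact hi_proof i : (i.+1 < n)%N.
Proof. by rewrite -ltn_predRL. Qed.
Definition lo i : 'I_n := Ordinal (ltnW (hi_proof i)).
Definition hi i : 'I_n := Ordinal (hi_proof i).

(* The coefficients of T_i at c_F eta, from c_F eta itself and from c_F' eta, where
   F' differs from F at [lo i] and [hi i]; they are found by moving T_i past c_F'.
   Here [chi b] is the eigenvalue at eta, [x = F (lo i)] and [y = F (hi i)]. *)
Definition chi (b : bool) : K := if b then -1 else 0.
Definition tdiag (b x y : bool) : K := chi (if b then ~~ x else y).
Definition toff (b x y : bool) : K :=
  if x then (if y then 0 else 1 + chi b) else (if y then chi b else 1).

Definition tact b i f : cspace :=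
  [ffun F : bits => tdiag b (F (lo i)) (F (hi i)) * f F
     + toff b (F (lo i)) (F (hi i)) * f (flip true (lo i) (flip true (hi i) F))].

Lemma tactE b i f F : tact b i f F =
  tdiag b (F (lo i)) (F (hi i)) * f F
     + toff b (F (lo i)) (F (hi i)) * f (flip true (lo i) (flip true (hi i) F)).
Proof. by rewrite ffunE. Qed.

Fact tact_linear b i : linear (tact b i).
Proof.
by move=> a f g; apply/ffunP => F; rewrite !ffunE /GRing.scale /=; ring.
Qed.
HB.instance Definition _ b i :=
  GRing.isLinear.Build K cspace cspace _ (tact b i) (tact_linear b i).

Lemma cact_sqr j f : cact j (cact j f) = - f.
Proof.
apply/ffunP => F; rewrite !ffunE flipK sgb_flip ltnn andbF addbF eqxx andbT.
by rewrite mulrA -signr_addb; case: (sgb j F); case: (F j); rewrite /=; ring.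
Qed.

Lemma cact_anticomm j k f : j != k -> cact j (cact k f) = - cact k (cact j f).
Proof.
move=> jk; apply/ffunP => F; rewrite !ffunE !sgb_flip (flipC _ _ j k).
rewrite [k == j]eq_sym (negPf jk) !andbF !addbF !mulrA -!signr_addb -mulNr.
rewrite /=; congr (_ * _).
case: ltngtP (jk) => [_ _|_ _|/val_inj ->]; last by rewrite eqxx.
  by case: (sgb j F); case: (sgb k F); case: (F j); case: (F k); rewrite /=; ring.
by case: (sgb j F); case: (sgb k F); case: (F j); case: (F k); rewrite /=; ring.
Qed.

Lemma lo_hi i : (lo i == hi i) = false.
Proof. by rewrite -val_eqE /= ltn_eqF. Qed.

Lemma hi_lo i : (hi i == lo i) = false.
Proof. by rewrite eq_sym lo_hi. Qed.

Lemma sgb_hi i F : sgb (hi i) F = sgb (lo i) F (+) F (lo i).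
Proof. exact: sgb_next. Qed.

Lemma tact_sqr b i f : tact b i (tact b i f) = - tact b i f.
Proof.
apply/ffunP => F; rewrite [LHS]ffunE [tact b i f F]ffunE [tact b i f _]ffunE.
rewrite [RHS]ffunE [tact b i f F]ffunE !flipE !eqxx lo_hi hi_lo !andbT !andbF.
rewrite !addbF !addbT [flip _ _ (flip _ _ F)]flipC !flipK.
by case: b; case: (F (lo i)); case: (F (hi i)); rewrite /tdiag /toff /=; ring.
Qed.

Lemma tact_cact_far b i j f : j != i :> nat -> j != i.+1 :> nat ->
  tact b i (cact j f) = cact j (tact b i f).
Proof.
move=> ji ji1; apply/ffunP => F.
have jlo : (j == lo i) = false by apply/negP => /eqP E; rewrite E eqxx in ji.
have jhi : (j == hi i) = false by apply/negP => /eqP E; rewrite E eqxx in ji1.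
rewrite tactE !cactE tactE !sgb_flip !flipE jlo jhi.
rewrite ![_ == j]eq_sym jlo jhi !andbF !addbF /=.
have -> : (i.+1 < j)%N = (i < j)%N.
  by rewrite [RHS]leq_eqVlt [i.+1 == j]eq_sym (negPf ji1).
rewrite addbK [flip true j (flip _ _ _)]flipC [flip true j (flip _ _ _)]flipC.
by ring.
Qed.

Lemma ltn_lo_hi i : (lo i < hi i)%N = true.
Proof. exact: ltnSn. Qed.

Lemma ltn_hi_lo i : (hi i < lo i)%N = false.
Proof. by rewrite ltnNge leqnSn. Qed.

Let bitE := (sgb_hi, sgb_flip, flipE, lo_hi, hi_lo, ltn_lo_hi, ltn_hi_lo,
  eqxx, ltnn, andbT, andbF, addbF).

Lemma tact_cact_lo b i f : tact b i (cact (lo i) f) = cact (hi i) (tact b i f).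
Proof.
apply/ffunP => F; rewrite !(tactE, cactE) !bitE.
rewrite ?[flip true (hi i) (flip _ (lo i) _)]flipC !flipK.
by case: b; case: (sgb (lo i) F); case: (F (lo i)); case: (F (hi i));
  rewrite /tdiag /toff /=; ring.
Qed.

Lemma tact_cact_hi b i f :
  tact b i (cact (hi i) f) + cact (hi i) f =
  cact (lo i) (tact b i f) + cact (lo i) f.
Proof.
apply/ffunP => F; rewrite [LHS]ffunE [RHS]ffunE !(tactE, cactE) !bitE.
rewrite ?[flip true (hi i) (flip _ (lo i) _)]flipC !flipK.
by case: b; case: (sgb (lo i) F); case: (F (lo i)); case: (F (hi i));
  rewrite /tdiag /toff /=; ring.
Qed.

Lemma tact_far b b' i i' f : (i.+1 < i')%N ->
  tact b i (tact b' i' f) = tact b' i' (tact b i f).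
Proof.
move=> ii'; have D : [/\ (lo i == lo i') = false, (lo i == hi i') = false,
    (hi i == lo i') = false & (hi i == hi i') = false].
  by split; apply/negP => /eqP /(congr1 val) /= E; move: ii';
     rewrite -?E ?(eq_add_S _ _ E) ltnNge; lia.
case: D => D1 D2 D3 D4.
have D5 : (lo i' == lo i) = false by rewrite eq_sym.
have D6 : (hi i' == lo i) = false by rewrite eq_sym.
have D7 : (lo i' == hi i) = false by rewrite eq_sym.
have D8 : (hi i' == hi i) = false by rewrite eq_sym.
apply/ffunP => F.
rewrite !tactE !(flipE, D1, D2, D3, D4, D5, D6, D7, D8, andbF, addbF).
have -> : flip true (lo i') (flip true (hi i') (flip true (lo i) (flip true (hi i) F)))
    = flip true (lo i) (flip true (hi i) (flip true (lo i') (flip true (hi i') F))).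
  by apply/ffunP => k; rewrite !flipE; case: (F k); do 4!case: (k == _).
by ring.
Qed.

(** Only the bits at three consecutive sites move. In the coordinates [G F x y z] the relation is a
    linear identity in the values of [f], checked for each choice of [b], [b'] and the three
    bits. *)
Lemma tact_braid b b' i i' f : i' = i.+1 :> nat ->
  tact b i (tact b' i' (tact b i f)) = tact b' i' (tact b i (tact b' i' f)).
Proof.
move=> ii'; have hl : hi i = lo i' by apply: val_inj.
pose G F x y z := flip x (lo i) (flip y (lo i') (flip z (hi i') F)).
have lh : (lo i == hi i') = false by rewrite -val_eqE /= ii' ltn_eqF.
have hl' : (hi i' == lo i) = false by rewrite eq_sym.
have ll : (lo i == lo i') = false by rewrite -val_eqE /= ii' ltn_eqF.
have ll' : (lo i' == lo i) = false by rewrite eq_sym.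
have E1 c g F x y z : tact c i g (G F x y z) =
   tdiag c (F (lo i) (+) x) (F (lo i') (+) y) * g (G F x y z) +
   toff c (F (lo i) (+) x) (F (lo i') (+) y) * g (G F (~~ x) (~~ y) z).
  rewrite tactE hl /G !(flipE, eqxx, lo_hi, hi_lo, lh, hl', ll, ll', andbF, andbT, addbF).
  by rewrite ![flip _ (lo i') (flip _ (lo i) _)]flipC !flipD.
have E2 c g F x y z : tact c i' g (G F x y z) =
   tdiag c (F (lo i') (+) y) (F (hi i') (+) z) * g (G F x y z) +
   toff c (F (lo i') (+) y) (F (hi i') (+) z) * g (G F x (~~ y) (~~ z)).
  rewrite tactE /G !(flipE, eqxx, lo_hi, hi_lo, lh, hl', ll, ll', andbF, andbT, addbF).
  rewrite ![flip _ _ (flip _ (lo i) _)]flipC.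
  by rewrite ![flip _ (hi i') (flip _ (lo i') _)]flipC !flipD.
have G0 F : F = G F false false false by rewrite /G !flip0.
apply/ffunP => F; rewrite [F]G0; clearbody G; clear G0.
rewrite !(E1, E2) !addbF !addbT !negbK.
clear E1 E2.
by case: b; case: b'; case: (F (lo i)); case: (F (lo i')); case: (F (hi i'));
  rewrite /tdiag /toff /=; ring.
Qed.

End CliffordOperators.

(** * Compositions with prescribed descents *)

Lemma descents_cons a r : descents (a :: r) =
  if r is [::] then [::] else a :: map (addn a) (descents r).
Proof.
case: r => [|b r] //; rewrite /descents /= addn0; congr cons.
rewrite -[2%N]/(1 + 1)%N iotaDl -!map_comp; exact: eq_map.
Qed.

(** Induction on n: from a composition for the shifted predicate, either a part 1 is put in front or
    the first part grows by one, according to whether 1 is to be a descent. *)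
Lemma comp_of_descents n (p : pred nat) : {beta | is_comp n beta
  & forall x, (x \in descents beta) = (0 < x < n)%N && p x}.
Proof.
elim: n p => [|[|n] IH] p; first by exists [::] => //; case.
  by exists [:: 1%N] => // -[|[|x]].
have [[//|a r] hc hd] := IH (p \o S).
have hs x : (x \in map (addn 1) (descents (a :: r))) =
    [&& (1 < x)%N, (x < n.+2)%N & p x].
  case: x => [|x]; first by apply/mapP => -[].
  by rewrite (mem_map (@addnI 1)) hd /= !ltnS andbA.
case p1 : (p 1%N).
  exists (1 :: a :: r)%N.
    by move: hc; rewrite /is_comp /= => /andP[-> /eqP <-] /=.
  move=> x; rewrite descents_cons inE hs.
  by case: x => [|[|x]] //=; rewrite p1.
exists (a.+1 :: r)%N.
  by move: hc; rewrite /is_comp /= => /andP[/andP[_ ->] /eqP <-] /=.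
move=> x; have -> : descents (a.+1 :: r) = map (addn 1) (descents (a :: r)).
  rewrite !descents_cons; case: (r) => //= b s; rewrite add1n; congr cons.
  by rewrite -map_comp; apply: eq_map => y.
by rewrite hs; case: x => [|[|x]] //=; rewrite p1 andbF.
Qed.

Section Desc.
Variable n : nat.

Definition desc (beta : seq nat) (i : 'I_n.-1) : bool := i.+1 \in descents beta.

Definition comp_of (d : 'I_n.-1 -> bool) : seq nat :=
  s2val (comp_of_descents n (fun x => [exists i : 'I_n.-1, (x == i.+1) && d i])).

Lemma comp_ofP d : is_comp n (comp_of d).
Proof. by rewrite /comp_of; case: comp_of_descents. Qed.

Lemma desc_comp_of d : desc (comp_of d) =1 d.
Proof.
move=> i; rewrite /desc /comp_of; case: comp_of_descents => /= b _ ->.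
rewrite -ltn_predRL ltn_ord /=; apply/existsP/idP => [[j]|di].
  by rewrite eqSS => /andP[/eqP /val_inj ->].
by exists i; rewrite eqxx.
Qed.

Definition comp_of_set (P : {set 'I_n.+1}) : seq nat :=
  s2val (comp_of_descents n (fun x => inord x \in P)).

Lemma comp_of_setP P : is_comp n (comp_of_set P).
Proof. by rewrite /comp_of_set; case: comp_of_descents. Qed.

Lemma mem_comp_of_set P x :
  (x \in descents (comp_of_set P)) = (0 < x < n)%N && (inord x \in P).
Proof. by rewrite /comp_of_set; case: comp_of_descents. Qed.

Lemma peak_setP (P : {set 'I_n.+1}) : is_peak_set P ->
  (forall x, x \in P -> (1 < x < n)%N) /\
  (forall x y, x \in P -> y \in P -> x != y.+1 :> nat).
Proof.
case/andP => /forallP h1 /forallP h2; split=> [x xP|x y xP yP].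
  by move: (h1 x); rewrite xP.
by move: (h2 x); rewrite xP /= => /forallP/(_ y); rewrite yP.
Qed.

Lemma peaks_peak_set beta : is_peak_set (peaks n beta).
Proof.
apply/andP; split; apply/forallP => x; apply/implyP; rewrite !inE => /and3P[+ hx hx1] //.
move=> _; apply/forallP => y; apply/implyP; rewrite !inE => /and3P[_ _ hy].
by apply/negP => /eqP E; move: hx; rewrite E /= hy.
Qed.

Lemma peaks_comp_of_set P : is_peak_set P -> peaks n (comp_of_set P) = P.
Proof.
move=> /peak_setP[h1 h2]; apply/setP => x; rewrite inE !mem_comp_of_set.
rewrite inord_val; apply/and3P/idP => [[_ _ /andP[]] //|xP].
have := h1 x xP => /andP[x1 xn]; rewrite x1 xn xP andbT; split=> //; last first.
  by rewrite (ltnW x1).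
rewrite negb_and; apply/orP; right; apply/negP => /(h2 _ _ xP).
by rewrite inordK ?prednK ?eqxx //; lia.
Qed.
End Desc.

(** * Simultaneous eigenvectors and Frobenius reciprocity *)

Section HeckeActions.
Variables (K : fieldType) (n : nat).
Notation H := (hecke K n).
Notation A := (hecke_clifford K n).

Definition hc_T (i : 'I_n.-1) : A := pgen K (@hecke_clifford_rels n) (inl i).
Definition hc_c (j : 'I_n) : A := pgen K (@hecke_clifford_rels n) (inr j).
Fact hc_scal_subproof : {f : {rmorphism K -> A} | f =1 pscal (@hecke_clifford_rels n)}.
Proof. by exists (pscal (@hecke_clifford_rels n)). Qed.
Definition hc_scal : {rmorphism K -> A} := sval hc_scal_subproof.

Lemma hc_scalE : hc_scal =1 pscal (@hecke_clifford_rels n).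
Proof. exact: svalP hc_scal_subproof. Qed.

Lemma hc_scalC k a : hc_scal k * a = a * hc_scal k.
Proof. by rewrite hc_scalE; apply: pscal_central. Qed.

Notation iota := (hecke_incl K n).

Lemma iota_gen i : iota (pgen K (@hecke_rels n) i) = hc_T i.
Proof. by rewrite /= peval_gen. Qed.

Lemma iota_scal k : iota (pscal (@hecke_rels n) k) = hc_scal k.
Proof. by rewrite hc_scalE /= peval_scal. Qed.

Lemma hecke_char_desc beta beta' : desc beta =1 @desc n beta' ->
  hecke_char K n beta =1 hecke_char K n beta'.
Proof.
move=> d; apply: presented_ind => [k|i|x y IHx IHy|x y IHx IHy].
- by rewrite /= !peval_scal.
- rewrite /= !peval_gen /= /hecke_char_gen.
  by have := d i; rewrite /desc => ->.
- by rewrite !rmorphD IHx IHy.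
- by rewrite !rmorphM IHx IHy.
Qed.

Lemma hecke_char_T beta i : hecke_char K n beta (pgen K (@hecke_rels n) i) =
  chi K (desc beta i).
Proof. by rewrite /hecke_char /= peval_gen. Qed.

Lemma hecke_char_k beta k : hecke_char K n beta (pscal (@hecke_rels n) k) = k.
Proof. by rewrite /hecke_char /= peval_scal. Qed.

(* [u] spans a quotient of S_beta. *)
Definition eigen (Y : lmodType A) (beta : seq nat) (u : Y) :=
  forall i, hc_T i *: u = hc_scal (chi K (desc beta i)) *: u.

Lemma eigenP (Y : lmodType A) beta (u : Y) : eigen beta u ->
  forall h, iota h *: u = hc_scal (hecke_char K n beta h) *: u.
Proof.
move=> e; apply: presented_ind => [k|i|x y IHx IHy|x y IHx IHy].
- by rewrite iota_scal hecke_char_k.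
- by rewrite iota_gen e hecke_char_T.
- by rewrite !rmorphD !scalerDl IHx IHy.
by rewrite !rmorphM -scalerA IHy !scalerA -hc_scalC -scalerA IHx scalerA hc_scalC.
Qed.

Lemma eigen_lin (Y Z : lmodType A) (f : {linear Y -> Z}) beta u :
  eigen beta u -> eigen beta (f u).
Proof. by move=> e i; rewrite -!linearZ e. Qed.

Definition eta beta : Ind (hecke_simple K n beta) :=
  tpure iota 1 ((1 : K) : hecke_simple K n beta).

Section SimpleLift.
Variables (Y : lmodType A) (beta : seq nat) (u : Y).
Hypothesis hu : eigen beta u.
Let f (x : hecke_simple K n beta) : Y := hc_scal (x : K) *: u.

Fact simple_lift_add x y : f (x + y) = f x + f y.
Proof. by rewrite /f rmorphD scalerDl. Qed.
Fact simple_lift_scale h x : f (h *: x) = iota h *: f x.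
Proof.
rewrite /f scalerA -hc_scalC -scalerA (eigenP hu) scalerA -rmorphM mulrC.
by [].
Qed.
Definition simple_lift : {linear Ind (hecke_simple K n beta) -> Y} :=
  ind_lift (@hecke_incl_even K n) simple_lift_add simple_lift_scale.
Lemma simple_lift_eta : simple_lift (eta beta) = u.
Proof. by rewrite /simple_lift ind_lift_pure scale1r /f rmorph1 scale1r. Qed.
End SimpleLift.

Lemma hecke_simple_gen beta (x : hecke_simple K n beta) :
  x = pscal (@hecke_rels n) (x : K) *: ((1 : K) : hecke_simple K n beta).
Proof.
rewrite [RHS]/GRing.scale /= /hecke_simple_scale -/(hecke_char _ _ _).
by rewrite hecke_char_k mulr1.
Qed.

Lemma ind_simple_ext (Y : lmodType A) beta
    (f g : {linear Ind (hecke_simple K n beta) -> Y}) :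
  f (eta beta) = g (eta beta) -> f =1 g.
Proof.
move=> fg; apply: tensor_lin_ext => x.
by rewrite [x]hecke_simple_gen tpureZ !linearZ /= fg.
Qed.

Lemma eta_eigen beta : eigen beta (eta beta).
Proof.
move=> i; rewrite -iota_gen -tpureZ -iota_scal -tpureZ; congr (tpure _ _ _).
rewrite /GRing.scale /= /hecke_simple_scale -!/(hecke_char _ _ _).
by rewrite hecke_char_T hecke_char_k.
Qed.

End HeckeActions.

(** * The Clifford module *)

Section CliffordModule.
Variables (K : fieldType) (n : nat) (b : 'I_n.-1 -> bool).
Notation H := (hecke K n).
Notation A := (hecke_clifford K n).
Notation V := (cspace K n).

(** The product of [u] and [v] is [u] after [v], the order for which an interpretation in this ring
    gives a left module. *)
Definition cend : pzRingType := HB.pack 'End(V)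
  (GRing.Zmodule_isPzRing.Build 'End(V) (@comp_lfunA _ _ _ _ _) (@comp_lfun1l _ _ _)
     (@comp_lfun1r _ _ _) (@comp_lfunDl _ _ _ _) (@comp_lfunDr _ _ _ _)).

Definition cend_scal (k : K) : cend := k *: (\1%VF : 'End(V)).
Fact cend_scal_zmod : zmod_morphism cend_scal.
Proof. by move=> k l; rewrite /cend_scal scalerBl. Qed.
Fact cend_scal_monoid : monoid_morphism cend_scal.
Proof.
split=> [|k l]; first exact: scale1r.
apply/lfunP => f; rewrite [RHS]lfunE /=.
by rewrite !(scale_lfunE, id_lfunE) scalerA.
Qed.
HB.instance Definition _ := GRing.isZmodMorphism.Build K cend cend_scal
  cend_scal_zmod.
HB.instance Definition _ := GRing.isMonoidMorphism.Build K cend cend_scal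
  cend_scal_monoid.

Definition cend_gen (g : 'I_n.-1 + 'I_n) : cend :=
  match g with inl i => linfun (tact (b i) i) | inr j => linfun (cact j) end.

Fact cend_central k (u : cend) : cend_scal k * u = u * cend_scal k.
Proof.
apply/lfunP => f; rewrite [LHS]lfunE [RHS]lfunE /=.
by rewrite !(scale_lfunE, id_lfunE) linearZ.
Qed.

Lemma cendM (u v : cend) (f : V) : (u * v : cend) f = u (v f).
Proof. exact: comp_lfunE. Qed.

Fact cend_rels : hecke_clifford_rels cend_gen.
Proof.
split; split => /=.
- move=> i; apply/lfunP => f.
  by rewrite cendM [RHS]opp_lfunE !lfunE /= tact_sqr.
- move=> i j /orP[] ij; apply/lfunP => f; rewrite !cendM !lfunE /=.
    exact: tact_far.
  by apply/esym/tact_far.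
- move=> i j ij; apply/lfunP => f; rewrite !cendM !lfunE /=.
  exact: tact_braid.
- move=> j; apply/lfunP => f.
  by rewrite cendM [RHS]opp_lfunE [(1 : cend) f]id_lfunE !lfunE /= cact_sqr.
- move=> j k jk; apply/lfunP => f.
  by rewrite cendM [RHS]opp_lfunE cendM !lfunE /= cact_anticomm.
- move=> i j ij ij1; apply/lfunP => f; rewrite !cendM !lfunE /=.
  exact: tact_cact_far.
- move=> i j k ji ki; apply/lfunP => f; rewrite !cendM !lfunE /=.
  have -> : j = lo i by apply: val_inj.
  have -> : k = hi i by apply: val_inj.
  exact: tact_cact_lo.
- move=> i j k ji ki; apply/lfunP => f; rewrite mulrDl mulrDr mul1r mulr1.
  rewrite [LHS]add_lfunE [RHS]add_lfunE !cendM !lfunE /=.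
  have -> : j = lo i by apply: val_inj.
  have -> : k = hi i by apply: val_inj.
  exact: tact_cact_hi.
Qed.

Definition cinterp : interp K (@hecke_clifford_rels n) cend :=
  @Interp _ _ _ _ cend_scal cend_gen cend_central cend_rels.

Definition cmod_car : Type := V.
HB.instance Definition _ := GRing.Zmodule.on cmod_car.
Definition cmod_scale (a : A) (f : cmod_car) : cmod_car :=
  (peval cinterp a : 'End(V)) f.

Fact cmod_scaleA a a' x :
  cmod_scale a (cmod_scale a' x) = cmod_scale (a * a') x.
Proof. by rewrite /cmod_scale rmorphM cendM. Qed.
Fact cmod_scale1 : left_id 1 cmod_scale.
Proof. by move=> x; rewrite /cmod_scale rmorph1 [LHS]id_lfunE. Qed.
Fact cmod_scaleDr : right_distributive cmod_scale +%R.
Proof. by move=> a x y; apply: linearD. Qed.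
Fact cmod_scaleDl x : {morph cmod_scale^~ x : a a' / a + a'}.
Proof. by move=> a a'; rewrite /cmod_scale rmorphD [LHS]add_lfunE. Qed.
HB.instance Definition _ :=
  GRing.Zmodule_isLmodule.Build A cmod_car
    cmod_scaleA cmod_scale1 cmod_scaleDr cmod_scaleDl.
Definition cmod : lmodType A := cmod_car.

Lemma cmodT i (f : cmod) : hc_T K i *: f = tact (b i) i (f : V).
Proof.
rewrite /GRing.scale /= /cmod_scale /hc_T peval_gen /=.
exact: lfunE.
Qed.

Lemma cmodc j (f : cmod) : hc_c K j *: f = cact j (f : V).
Proof.
rewrite /GRing.scale /= /cmod_scale /hc_c peval_gen /=.
exact: lfunE.
Qed.

Lemma cmodk k (f : cmod) : hc_scal K n k *: f = k *: (f : V).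
Proof.
rewrite hc_scalE /GRing.scale /= /cmod_scale peval_scal /= /cend_scal.
by rewrite scale_lfunE id_lfunE.
Qed.

End CliffordModule.

(** * Eigenvectors and triangularity *)

Section Weights.
Variables (n : nat) (b : 'I_n.-1 -> bool).
Implicit Types (F : bits n) (i : 'I_n.-1) (j : 'I_n).

(* Chosen so that the off-diagonal part of every T_i lowers [bweight]. *)
Definition dweight j : nat :=
  (\sum_(i < n.-1) (((i < j) && ~~ b i) + ((j <= i) && b i)))%N.+1.

Definition bweight F : nat := (\sum_(j < n) F j * dweight j)%N.

(** Off the diagonal, T_i moves a single generator from [lo i] to [hi i] if [b i], and from [hi i]
    to [lo i] otherwise: in both cases to the lighter site. It may also remove a pair, which lowers
    the weight because [dweight] is positive. *)
Lemma dweight_hi i : (dweight (hi i) + b i = dweight (lo i) + ~~ b i)%N.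
Proof.
rewrite /dweight (bigD1 i) //= [in RHS](bigD1 i) //= ltnSn ltnn leqnn.
set s1 := (\sum_(i0 < _ | _) _)%N; set s2 := (\sum_(i0 < _ | _) _)%N.
suff -> : s1 = s2 by case: (b i); lia.
(* An index other than i does not separate the two sites. *)
apply: eq_bigr => i' ii'; rewrite ltnS [(i' <= i)%N]leq_eqVlt val_eqE (negPf ii').
by rewrite [(i <= i')%N]leq_eqVlt eq_sym val_eqE (negPf ii').
Qed.

Lemma bweight_lt (K : fieldType) i F : toff K (b i) (F (lo i)) (F (hi i)) != 0 ->
  (bweight F < bweight (flip true (lo i) (flip true (hi i) F)))%N.
Proof.
have hl : hi i != lo i by rewrite hi_lo.
rewrite /bweight (bigD1 (lo i)) //= (bigD1 (hi i)) //=.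
rewrite [X in _ -> (_ < X)%N](bigD1 (lo i)) //= [X in _ -> (_ < _ + X)%N](bigD1 (hi i)) //=.
have -> : (\sum_(j < n | (j != lo i) && (j != hi i))
    flip true (lo i) (flip true (hi i) F) j * dweight j)%N =
    (\sum_(j < n | (j != lo i) && (j != hi i)) F j * dweight j)%N.
  apply: eq_bigr => j /andP[/negPf jl /negPf jh].
  by rewrite !flipE jl jh !addbF.
move: (\sum_(j < n | _) F j * dweight j)%N => S.
rewrite !flipE !eqxx lo_hi hi_lo /= !addbF !addbT.
have := dweight_hi i; have : (0 < dweight (lo i))%N by [].
rewrite /toff; case: (F (lo i)); case: (F (hi i)); case: (b i);
  rewrite /= ?eqxx ?subrr ?eqxx // => *; lia.
Qed.

Definition diag_char F i : bool := if b i then ~~ F (lo i) else F (hi i).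

(** Equivalently, [diag_char F] is [b]. For such F, c_F eta is a true eigenvector and not only one
    up to lower terms. *)
Definition own_type F : bool := [forall i, ~~ (if b i then F (lo i) else F (hi i))].

End Weights.

Section Eigenvectors.
Variables (K : fieldType) (n : nat) (beta : seq nat).
Notation b := (@desc n beta).
Notation V := (cmod K b).
Implicit Types (f : V) (F : bits n) (i : 'I_n.-1) (j : 'I_n).

Lemma cmodTE i f F : (hc_T K i *: f : cspace K n) F =
  tdiag K (b i) (F (lo i)) (F (hi i)) * (f : cspace K n) F
  + toff K (b i) (F (lo i)) (F (hi i))
    * (f : cspace K n) (flip true (lo i) (flip true (hi i) F)).
Proof. by rewrite cmodT tactE. Qed.

Lemma cmodkE k f F : (hc_scal K n k *: f : cspace K n) F = k * (f : cspace K n) F.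
Proof. by rewrite cmodk ffunE. Qed.

(** If F violates [own_type] at i, no off-diagonal term of T_i arrives at F and the diagonal entry
    is the wrong one of 0 and -1, so the coefficient of an eigenvector vanishes there. *)
Lemma eigen_cmod f :
  eigen beta f <-> forall F, ~~ own_type b F -> (f : cspace K n) F = 0.
Proof.
split=> [e F /forallPn[i]|h i]; last first.
  apply/(@ffunP (bits n) (fun=> K)) => F; rewrite cmodTE cmodkE.
  have f0 F' : (if b i then F' (lo i) else F' (hi i)) -> (f : cspace K n) F' = 0.
    by move=> hF; apply: h; apply/forallPn; exists i; rewrite hF.
  have := f0 F; have := f0 (flip true (lo i) (flip true (hi i) F)).
  rewrite !flipE !eqxx lo_hi hi_lo /= !addbF !addbT /tdiag /toff.
  case: (b i); case: (F (lo i)); case: (F (hi i)) => /= h1 h2;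
    try rewrite (h1 isT); try rewrite (h2 isT); ring.
have /(congr1 (fun g : V => (g : cspace K n) F)) := e i.
rewrite cmodTE cmodkE negbK /tdiag /toff; case: (b i) => /= + hF; rewrite hF /=.
  move=> E; apply/eqP; rewrite -oppr_eq0 -[- _]mulN1r -E; apply/eqP.
  by case: (F _) => /=; ring.
move=> E; apply/eqP; rewrite -oppr_eq0 -[- _]mulN1r; apply/eqP.
by move: E; case: (F _) => /=; rewrite !mul0r addr0 => ->.
Qed.

(** The source of Hom(S_P, S_Q) = 0. The common non-descent i' kills every coefficient whose bit at
    [lo i] is set; on the others, the equation for T_i then fails unless they vanish. *)
Lemma eigen_cmod_eq0 beta' f i i' : eigen beta' f -> i = i'.+1 :> nat ->
  b i' = false -> desc beta' i' = false -> b i != desc beta' i -> f = 0.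
Proof.
move=> e ii' bi' di' bd; have hl : hi i' = lo i by apply: val_inj.
have f0 F : F (lo i) -> (f : cspace K n) F = 0.
  move=> hF; have /(congr1 (fun g : V => (g : cspace K n) F)) := e i'.
  rewrite cmodTE cmodkE di' bi' hl hF /tdiag /toff /=.
  move=> E; apply/eqP; rewrite -oppr_eq0 -[- _]mulN1r; apply/eqP.
  by move: E; case: (F _) => /=; rewrite !mul0r addr0 => ->.
apply/(@ffunP (bits n) (fun=> K)) => F; rewrite [RHS]ffunE.
case hF : (F (lo i)); first exact: f0.
have e1 := e i.
move/(congr1 (fun g : V => (g : cspace K n) F)) : (e1).
set F' := flip true (lo i) (flip true (hi i) F).
have F'0 : (f : cspace K n) F' = 0.
  by apply: f0; rewrite !flipE !eqxx lo_hi hF.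
(* The equation at F is void when [b i] is false and the bit at [hi i] is set; the one at F' then
   gives the vanishing. *)
move/(congr1 (fun g : V => (g : cspace K n) F')) : e1.
have F'F : flip true (lo i) (flip true (hi i) F') = F.
  by rewrite /F' [flip true (lo i) (flip _ _ F)]flipC !flipK.
rewrite !cmodTE !cmodkE F'F -/F' F'0 !flipE !eqxx lo_hi hi_lo hF /=.
rewrite /tdiag /toff /=; move: bd.
case: (b i); case: (desc _ i) => //= _; case: (F _) => /=;
  rewrite ?(mulr0, mul0r, add0r, addr0, mul1r, mulN1r) //.
- by move=> _ /eqP; rewrite oppr_eq0 => /eqP.
- by move=> _ /eqP; rewrite oppr_eq0 => /eqP.
by move=> _ /esym/eqP; rewrite oppr_eq0 => /eqP.
Qed.

(** Leading coefficients see [h] only through a character, so this applies to an idempotent of which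
    nothing else is known. *)
Lemma hecke_triangular (h : hecke K n) f F :
  (forall E, (bweight b F < bweight b E)%N -> (f : cspace K n) E = 0) ->
  (hecke_incl K n h *: f : cspace K n) F =
  hecke_char K n (comp_of (diag_char b F)) h * (f : cspace K n) F.
Proof.
move: h f F; apply: presented_ind => [k|i|x y IHx IHy|x y IHx IHy] f F hf.
- by rewrite iota_scal cmodkE hecke_char_k.
- rewrite iota_gen cmodTE hecke_char_T desc_comp_of -/(tdiag _ _ _ _).
  rewrite -[RHS]addr0; congr (_ + _).
  have [->|h] := eqVneq (toff K (b i) (F (lo i)) (F (hi i))) 0; first exact: mul0r.
  by rewrite hf ?mulr0 //; apply: bweight_lt h.
- by rewrite !rmorphD scalerDl [LHS]ffunE IHx // IHy // mulrDl.
rewrite !rmorphM -scalerA IHx.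
  by rewrite IHy // mulrA.
(* Acting by [y] keeps the vanishing above F: there it multiplies a zero coefficient by a scalar. *)
move=> E hE; rewrite IHy ?hf ?mulr0 // => E' hE'; apply: hf.
exact: ltn_trans hE'.
Qed.

End Eigenvectors.

(** * The induced simple modules *)

Section CliffordWords.
Variables (K : fieldType) (n : nat).
Notation A := (hecke_clifford K n).
Notation hc_T := (@hc_T K n).
Notation hc_c := (@hc_c K n).
Implicit Types (s : seq 'I_n) (i : 'I_n.-1) (j : 'I_n).

Lemma hc_c_sqr j : hc_c j * hc_c j = -1.
Proof. by have [_ [h _ _ _ _]] := pgen_hecke_clifford K n; apply: h. Qed.

Lemma hc_c_anticomm j k : j != k -> hc_c j * hc_c k = - (hc_c k * hc_c j).
Proof. by have [_ [_ h _ _ _]] := pgen_hecke_clifford K n; apply: h. Qed.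

Lemma hc_T_cg_far i j : j != lo i -> j != hi i -> hc_T i * hc_c j = hc_c j * hc_T i.
Proof. by have [_ [_ _ h _ _]] := pgen_hecke_clifford K n; apply: h. Qed.

Lemma hc_T_cg_lo i : hc_T i * hc_c (lo i) = hc_c (hi i) * hc_T i.
Proof. by have [_ [_ _ _ h _]] := pgen_hecke_clifford K n; apply: h. Qed.

Lemma hc_T_cg_hi i :
  hc_T i * hc_c (hi i) = hc_c (lo i) * hc_T i + hc_c (lo i) - hc_c (hi i).
Proof.
have [_ [_ _ _ _ h]] := pgen_hecke_clifford K n.
have := h i (lo i) (hi i) erefl erefl; rewrite mulrDl mul1r mulrDr mulr1 => <-.
by rewrite addrK.
Qed.

Definition hc_word s : A := \prod_(j <- s) hc_c j.

Lemma hc_word_nil : hc_word [::] = 1. Proof. exact: big_nil. Qed.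
Lemma hc_word_cons j s : hc_word (j :: s) = hc_c j * hc_word s. Proof. exact: big_cons. Qed.

Lemma hc_word_unit s : exists a, hc_word s * a = 1 /\ a * hc_word s = 1.
Proof.
elim: s => [|j s [a [h1 h2]]]; first by exists 1; rewrite hc_word_nil mulr1.
exists (- (a * hc_c j)); rewrite hc_word_cons; split.
  by rewrite mulrN -mulrA (mulrA (hc_word s)) h1 mul1r hc_c_sqr opprK.
by rewrite mulNr -mulrA (mulrA (hc_c j)) hc_c_sqr mulN1r mulrN h2 opprK.
Qed.

Lemma hc_word_gr s : sr_gr (odd (size s)) (hc_word s).
Proof.
elim: s => [|j s IH]; first by rewrite hc_word_nil; apply: sr_one.
rewrite hc_word_cons /= -addTb; apply: (@sr_mul A true) => //.
exact: (@pgrade_gen K _ _ (@hc_par n) (inr j)).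
Qed.

(** The inclusion in [j :: s] serves the induction: once c_j has passed c_k, it shows that k is
    still below every letter of the new word. *)
Lemma hc_c_cw_sorted j s : sorted ltn (map val s) -> exists s' (e : bool),
  [/\ sorted ltn (map val s'), {subset s' <= j :: s}
    & hc_c j * hc_word s = (-1) ^+ e * hc_word s'].
Proof.
elim: s => [|k s IH] hs.
  by exists [:: j], false; split; rewrite // mul1r hc_word_cons.
case: (ltngtP j k) => [jk|kj|/val_inj <-].
- exists [:: j, k & s], false; split=> //; last by rewrite mul1r [RHS]hc_word_cons.
  by rewrite /= jk.
- have [s' [e [hs' ss' E]]] := IH (path_sorted hs).
  exists (k :: s'), (~~ e); split.
  + rewrite /= path_min_sorted //; apply/allP => _ /mapP[l /ss' ls ->].
    move: ls; rewrite inE => /orP[/eqP -> //|ls].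
    have /(order_path_min ltn_trans)/allP h : path ltn k (map val s) := hs.
    by apply: h; apply: map_f.
  + move=> l; rewrite inE => /orP[/eqP ->|/ss']; first by rewrite !inE eqxx orbT.
    by rewrite !inE => /orP[->|->] //; rewrite !orbT.
  + rewrite !hc_word_cons mulrA hc_c_anticomm -?val_eqE ?gtn_eqF //.
    rewrite mulNr -mulrA E signrN !mulNr; congr (- _).
    by rewrite !mulrA; congr (_ * _); case: (e); rewrite ?mul1r ?mulr1 // mulN1r mulrN1.
- exists s, true; split; first exact: path_sorted hs.
    by move=> l ls; rewrite !inE ls !orbT.
  by rewrite hc_word_cons mulrA hc_c_sqr.
Qed.

Definition enum_bits (F : bits n) : seq 'I_n := [seq j <- enum 'I_n | F j].

Lemma sorted_enum_bits (F : bits n) : sorted ltn (map val (enum_bits F)).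
Proof.
have h : sorted (relpre val ltn) (enum 'I_n).
  by rewrite -sorted_map val_enum_ord iota_ltn_sorted.
rewrite sorted_map; apply: sorted_filter h => j k l; exact: ltn_trans.
Qed.

Lemma sorted_enum_bitsE s : sorted ltn (map val s) ->
  s = enum_bits [ffun j => j \in s].
Proof.
move=> hs; apply: (inj_map val_inj).
apply: (irr_sorted_eq ltn_trans ltnn) => // [|x]; first exact: sorted_enum_bits.
apply/mapP/mapP => -[j js ->]; exists j => //.
  by rewrite mem_filter ffunE js mem_enum.
by move: js; rewrite mem_filter ffunE => /andP[].
Qed.

Definition flips s (F : bits n) : bits n := [ffun k => F k (+) odd (count_mem k s)].

Lemma flips_cons j s F : flips s (flip true j F) = flips (j :: s) F.
Proof.
apply/ffunP => k; rewrite !ffunE /= -addbA; congr addb.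
by rewrite oddD eq_sym; case: eqP.
Qed.

Lemma flipsK s : involutive (flips s).
Proof. by move=> F; apply/ffunP => k; rewrite !ffunE addbK. Qed.

Lemma flips_enum_bits (E F : bits n) : flips (enum_bits E) F = [ffun k => F k (+) E k].
Proof.
apply/ffunP => k; rewrite !ffunE; congr addb.
rewrite /enum_bits count_uniq_mem; last exact/filter_uniq/enum_uniq.
rewrite mem_filter mem_enum andbT.
by case: (E k).
Qed.

(** Words act by signed permutations of the coefficients. The signs stay unspecified because only
    supports matter later. *)
Lemma hc_word_act (b : 'I_n.-1 -> bool) s : exists sg : bits n -> bool,
  forall (f : cmod K b) F,
  (hc_word s *: f : cspace K n) F = (-1) ^+ sg F * (f : cspace K n) (flips s F).
Proof.
elim: s => [|j s [sg IH]].
  exists (fun=> false) => f F; rewrite hc_word_nil scale1r mul1r; congr (f _).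
  by apply/ffunP => k; rewrite !ffunE addbF.
exists (fun F => sgb j F (+) ~~ F j (+) sg (flip true j F)) => f F.
rewrite hc_word_cons -scalerA cmodc cactE IH flips_cons mulrA.
by rewrite [in RHS]signr_addb.
Qed.

End CliffordWords.

Section InducedSimple.
Variables (K : fieldType) (n : nat) (beta : seq nat).
Notation A := (hecke_clifford K n).
Notation b := (@desc n beta).
Notation V := (cmod K b).
Notation S := (Ind (hecke_simple K n beta)).
Notation eta := (@eta K n beta).

(** Unsorted words come first: stability under T_i then follows by pushing T_i through the word,
    with no signs to track. Sorting is left to [ind_simple_span]. *)
Let wspan (x : S) : Prop := exists l : seq (K * seq 'I_n),
  x = \sum_(t <- l) hc_scal K n t.1 *: (hc_word K t.2 *: eta).

Let wspan0 : wspan 0. Proof. by exists [::]; rewrite big_nil. Qed.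
Let wspanD x y : wspan x -> wspan y -> wspan (x + y).
Proof. by move=> [l ->] [l' ->]; exists (l ++ l'); rewrite big_cat. Qed.
Let wspank k x : wspan x -> wspan (hc_scal K n k *: x).
Proof.
move=> [l ->]; exists [seq (k * t.1, t.2) | t <- l].
rewrite big_map scaler_sumr; apply: eq_bigr => t _.
by rewrite [in LHS]scalerA -rmorphM.
Qed.
Let wspan_cw s : wspan (hc_word K s *: eta).
Proof. by exists [:: (1, s)]; rewrite big_seq1 /= rmorph1 scale1r. Qed.
Let wspan_sum (a : A) (x : S) : (forall s, wspan (a *: (hc_word K s *: eta))) ->
  wspan x -> wspan (a *: x).
Proof.
move=> h [l ->]; rewrite scaler_sumr; apply: big_ind => // t _.
by rewrite scalerA -hc_scalC -scalerA; apply: wspank.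
Qed.
Let wspanc j x : wspan x -> wspan (hc_c K j *: x).
Proof. by apply: wspan_sum => s; rewrite scalerA -hc_word_cons. Qed.
Let wspanT i x : wspan x -> wspan (hc_T K i *: x).
Proof.
apply: wspan_sum => s; elim: s => [|j s IH].
  by rewrite hc_word_nil scale1r eta_eigen; apply: wspank; rewrite -[eta]scale1r -(hc_word_nil K n).
rewrite hc_word_cons -scalerA scalerA.
have [->|jl] := eqVneq j (lo i).
  by rewrite hc_T_cg_lo -scalerA; apply: wspanc.
have [->|jh] := eqVneq j (hi i).
  rewrite hc_T_cg_hi scalerBl scalerDl -scalerA; apply: wspanD; first apply: wspanD.
  - exact: wspanc.
  - exact: wspanc.
  by rewrite -scaleN1r -(rmorph1 (hc_scal K n)) -rmorphN; apply/wspank/wspanc.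
by rewrite hc_T_cg_far // -scalerA; apply: wspanc.
Qed.
Let wspan_all x : wspan x.
Proof.
rewrite [x]tensorE; apply: big_ind => // -[a m] _ /=.
have -> : tpure (hecke_incl K n) a m = a *: (hc_scal K n (m : K) *: eta) :> S.
  by rewrite -iota_scal -tpureZ -hecke_simple_gen tpure_scale mulr1.
have : wspan (hc_scal K n (m : K) *: eta).
  by apply: wspank; rewrite -[eta]scale1r -(hc_word_nil K n).
move: (_ *: eta); move: a; apply: presented_ind => [k|[i|j]|u v IHu IHv|u v IHu IHv] y hy.
- by rewrite -hc_scalE; apply: wspank.
- exact: wspanT.
- exact: wspanc.
- by rewrite scalerDl; apply: wspanD; [apply: IHu | apply: IHv].
- by rewrite -scalerA; apply/IHu/IHv.
Qed.

Let bspan (x : S) := exists k : bits n -> K,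
  x = \sum_F hc_scal K n (k F) *: (hc_word K (enum_bits F) *: eta).

Lemma ind_simple_span (x : S) : exists k : bits n -> K,
  x = \sum_F hc_scal K n (k F) *: (hc_word K (enum_bits F) *: eta).
Proof.
rewrite -/(bspan x).
have bD y z : bspan y -> bspan z -> bspan (y + z).
  move=> [k ->] [l ->]; exists (fun F => k F + l F).
  by rewrite -big_split; apply: eq_bigr => F _; rewrite rmorphD scalerDl.
have bk k y : bspan y -> bspan (hc_scal K n k *: y).
  move=> [l ->]; exists (fun F => k * l F).
  by rewrite scaler_sumr; apply: eq_bigr => F _; rewrite rmorphM [in LHS]scalerA.
have b1 F : bspan (hc_word K (enum_bits F) *: eta).
  exists (fun F' => (F' == F)%:R); rewrite (bigD1 F) //= eqxx rmorph1 scale1r.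
  by rewrite big1 ?addr0 // => F' /negPf ->; rewrite rmorph0 scale0r.
have b0 : bspan 0.
  by exists (fun=> 0); rewrite big1 // => F _; rewrite rmorph0 scale0r.
have bc j y : bspan y -> bspan (hc_c K j *: y).
  move=> [k ->]; rewrite scaler_sumr; apply: (big_ind bspan) => // F _.
  rewrite scalerA -hc_scalC -scalerA; apply: (bk); rewrite scalerA.
  have [s' [e [hs' _ ->]]] := hc_c_cw_sorted K j (sorted_enum_bits F).
  rewrite (sorted_enum_bitsE hs') -scalerA.
  by rewrite -(rmorph1 (hc_scal K n)) -rmorphN -rmorphXn; apply: bk.
have [l ->] := wspan_all x; apply: (big_ind bspan) => // -[k s] _ /=.
apply: bk; elim: s => [|j s IH]; last by rewrite hc_word_cons -scalerA; apply: bc.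
by have := b1 [ffun j => j \in [::]]; rewrite -sorted_enum_bitsE.
Qed.

Lemma eigen_cmod_vac : eigen beta ([ffun F : bits n => (F == [ffun=> false])%:R] : V).
Proof.
apply/eigen_cmod => F hF; rewrite ffunE; case: eqP => // E.
case/negP: hF; apply/forallP => i; rewrite E !ffunE.
by case: ifP.
Qed.

(** Each c_F eta goes to the indicator of F up to sign, which makes the family of [ind_simple_span]
    free. *)
Definition to_cmod : {linear S -> V} := simple_lift eigen_cmod_vac.

Lemma to_cmod_span : exists sgn : bits n -> bool, forall (k : bits n -> K) F,
  (to_cmod (\sum_F hc_scal K n (k F) *: (hc_word K (enum_bits F) *: eta)) : cspace K n) F
  = (-1) ^+ sgn F * k F.
Proof.
have /choice[sg hc_wordE] E := @hc_word_act K n b (enum_bits E).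
exists (fun F => sg F F) => k F.
rewrite linear_sum sum_ffunE (bigD1 F) //= big1 => [|E hE].
  rewrite addr0 !linearZ /= simple_lift_eta cmodkE hc_wordE ffunE flips_enum_bits.
  have -> : [ffun k0 => F k0 (+) F k0] = [ffun=> false] :> bits n.
    by apply/ffunP => j; rewrite !ffunE addbb.
  by rewrite eqxx mulr1 mulrC.
rewrite !linearZ /= simple_lift_eta cmodkE hc_wordE ffunE flips_enum_bits.
case: eqP => [h|]; last by rewrite !mulr0.
case/eqP: hE; apply/ffunP => j; have /(congr1 (fun g : bits n => g j)) := h.
by rewrite !ffunE; case: (F j); case: (E j).
Qed.

Lemma to_cmod_eq0 x : to_cmod x = 0 -> x = 0.
Proof.
have [sg cE] := to_cmod_span; have [k ->] := ind_simple_span x => E.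
rewrite big1 // => F _; suff -> : k F = 0 by rewrite rmorph0 scale0r.
have /(congr1 (fun g : V => (g : cspace K n) F)) := E.
by rewrite cE ffunE => /eqP; rewrite mulf_eq0 signr_eq0 /= => /eqP.
Qed.

Lemma to_cmod_inj x y : to_cmod x = to_cmod y -> x = y.
Proof.
move=> e; apply/eqP; rewrite -subr_eq0; apply/eqP/to_cmod_eq0.
by rewrite linearB; apply/eqP; rewrite subr_eq0; apply/eqP.
Qed.

Lemma to_cmod_surj (f : V) : exists x, to_cmod x = f.
Proof.
have [sg cE] := to_cmod_span.
exists (\sum_F hc_scal K n ((-1) ^+ sg F * (f : cspace K n) F)
   *: (hc_word K (enum_bits F) *: eta)).
apply/(@ffunP (bits n) (fun=> K)) => F; rewrite cE mulrA -expr2.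
by rewrite sqrr_sign mul1r.
Qed.

End InducedSimple.

(** * Idempotents acting on the induced simple modules *)

Section Idempotent.
Variables (K : fieldType) (n : nat) (d : 'I_n.-1 -> bool) (e : hecke K n).
Notation A := (hecke_clifford K n).
Hypothesis ee : e * e = e.
Hypothesis eP : forall beta, hecke_char K n beta e = ([forall i, desc beta i == d i])%:R.
Variable beta : seq nat.
Notation b := (@desc n beta).
Notation V := (cmod K b).
Notation S := (Ind (hecke_simple K n beta)).
Notation eta := (@eta K n beta).
Notation to_cmod := (@to_cmod K n beta).
Notation eA := (hecke_incl K n e).

Definition compat (F : bits n) : bool := [forall i, diag_char b F i == d i].

Lemma hecke_char_diag F :
  hecke_char K n (comp_of (diag_char b F)) e = (compat F)%:R.
Proof.
by rewrite eP; congr (_ _)%:R; apply: eq_forallb => i; rewrite desc_comp_of.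
Qed.

Definition supported (p : pred (bits n)) (f : V) :=
  forall F, ~~ p F -> (f : cspace K n) F = 0.

(** At an F of maximal weight in the support of f, [eA] multiplies the coefficient by the character
    value 1. *)
Lemma idem_kill (f : V) : supported compat f -> eA *: f = 0 -> f = 0.
Proof.
move=> fs ef; apply/(@ffunP (bits n) (fun=> K)) => F0; rewrite [RHS]ffunE.
apply/eqP/negPn/negP => h0.
pose p F := (f : cspace K n) F != 0.
have [F pF hF] := @arg_maxnP _ F0 p (bweight b) h0.
have cF : compat F by apply/negPn/negP => /fs E; rewrite /p E eqxx in pF.
move/negP: pF; apply; have /(congr1 (fun g : V => (g : cspace K n) F)) := ef.
rewrite hecke_triangular ?hecke_char_diag ?cF ?mul1r ?ffunE => [->|E hE] //.
apply/eqP/negPn/negP => pE; have : (bweight b E <= bweight b F)%N := hF E pE.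
by rewrite leqNgt hE.
Qed.

(** Induction on a strict bound for the weights in x. On the non-compatible part z the leading terms
    are multiplied by the character value 0, so e z has smaller weights; and e z = e (e z). *)
Lemma idem_span (x : V) : exists2 f : V, supported compat f & eA *: x = eA *: f.
Proof.
suff IH m : forall x : V, (forall F, (m <= bweight b F)%N -> (x : cspace K n) F = 0) ->
    exists2 f : V, supported compat f & eA *: x = eA *: f.
  apply: (IH (\max_F bweight b F).+1) => F.
  by rewrite ltnNge leq_bigmax.
elim: m => [|m IH] {}x hx.
  have -> : x = 0 by apply/(@ffunP (bits n) (fun=> K)) => F; rewrite hx // ffunE.
  by exists 0 => // F _; rewrite ffunE.
pose w : V := [ffun F => if compat F then (x : cspace K n) F else 0].
pose z : V := [ffun F => if compat F then 0 else (x : cspace K n) F].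
have xE : x = w + z.
  apply/(@ffunP (bits n) (fun=> K)) => F; rewrite !ffunE.
  by case: ifP; rewrite ?addr0 ?add0r.
have ws : supported compat w by move=> F /negPf h; rewrite ffunE h.
have [|f fs E] := IH (eA *: z).
  move=> F hF; rewrite hecke_triangular ?hecke_char_diag.
    by rewrite ffunE; case: ifP; rewrite ?mulr0 ?mul0r.
  by move=> E hE; rewrite ffunE hx ?if_same //; apply: leq_ltn_trans hF hE.
exists (w + f) => [F hF|]; first by rewrite ffunE ws ?fs ?addr0.
by rewrite xE !scalerDr -E scalerA -rmorphM ee.
Qed.

Section Witness.
Variable E : bits n.
Hypothesis hE : compat E.

Definition witness : S := eA *: (hc_word K (enum_bits E) *: eta).

Lemma witness_idem : eA *: witness = witness.
Proof. by rewrite scalerA -rmorphM ee. Qed.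

(** For each i, [diag_char] depends on a single bit of F, so F and E have the same diagonal
    character iff that bit of their difference is zero for all i. *)
Lemma compat_own_type F : compat F = own_type b (flips (enum_bits E) F).
Proof.
apply: eq_forallb => i; move/forallP/(_ i)/eqP: hE => <-.
rewrite flips_enum_bits !ffunE /diag_char; case: (b i);
by case: (F _); case: (E _).
Qed.

Lemma witness_gr : sm_gr (odd (size (enum_bits E))) witness.
Proof.
rewrite -[odd _]addFb; apply: sm_act; first exact: hecke_incl_even.
by rewrite -[odd _]addbF; apply: sm_act; [apply: hc_word_gr | apply: tpure_even].
Qed.

(** f eta is an eigenvector, hence supported on [own_type]. Acting by c_E translates this support
    into [compat], where e is injective, and c_E is invertible. *)
Lemma witness_kill (f : {linear S -> S}) : f witness = 0 -> forall x, f x = 0.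
Proof.
move=> fw; suff E0 : f eta = 0.
  by move=> x; rewrite (@ind_simple_ext _ _ _ _ f \0%R) // E0.
apply: to_cmod_eq0; set g := to_cmod _.
have /eigen_cmod gs : eigen beta g by do 2!apply: eigen_lin; apply: eta_eigen.
have [a [_ aw]] := hc_word_unit K (enum_bits E).
rewrite -[g]scale1r -aw -scalerA.
suff -> : hc_word K (enum_bits E) *: g = 0 by rewrite scaler0.
apply: idem_kill; last by rewrite /g -!linearZ -/witness fw linear0.
have [sg cE] := @hc_word_act K n b (enum_bits E).
by move=> F; rewrite compat_own_type => /gs h; rewrite cE h mulr0.
Qed.

(** The same translation backwards: if x = e g with g supported on [compat], then c_E^-1 g is
    supported on [own_type], so it is an eigenvector to which eta can be sent. *)
Lemma witness_gen (x : S) : eA *: x = x ->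
  exists f : {linear S -> S}, f witness = x.
Proof.
move=> ex; have [g gs eg] := idem_span (to_cmod x).
have [a [wa _]] := hc_word_unit K (enum_bits E).
have gE : g = hc_word K (enum_bits E) *: (a *: g) by rewrite scalerA wa scale1r.
have [y hy] := to_cmod_surj (a *: g).
have ty : eigen beta (to_cmod y).
  rewrite hy; apply/eigen_cmod => F hF.
  have [sg cE] := @hc_word_act K n b (enum_bits E).
  have := gs (flips (enum_bits E) F); rewrite compat_own_type flipsK => /(_ hF).
  rewrite {1}gE cE flipsK => /eqP; rewrite mulf_eq0 signr_eq0 /=.
  by move/eqP.
have ye : eigen beta y.
  by move=> i; apply: to_cmod_inj; rewrite [LHS]linearZZ [RHS]linearZZ; apply: ty.
exists (simple_lift ye); apply: to_cmod_inj.
rewrite /witness [simple_lift ye _]linearZZ [X in to_cmod (_ *: X)]linearZZ simple_lift_eta.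
rewrite [LHS]linearZZ [X in _ *: X]linearZZ hy -gE -eg.
by rewrite -ex [RHS]linearZZ ex.
Qed.

End Witness.

Lemma no_witness (x : S) : ~~ [exists E, compat E] -> eA *: x = x -> x = 0.
Proof.
move=> h ex; have [g gs eg] := idem_span (to_cmod x).
apply: to_cmod_eq0; rewrite -ex linearZZ eg.
have -> : g = 0.
  apply/(@ffunP (bits n) (fun=> K)) => F; rewrite gs ?ffunE //.
  by apply: contraNN h => cF; apply/existsP; exists F.
exact: scaler0.
Qed.

End Idempotent.

(** * Peak sets and projective covers *)

Section PeakCombinatorics.
Variable n : nat.
Implicit Types (P Q : {set 'I_n.+1}) (i : 'I_n.-1).

Lemma desc_comp_of_set P i : desc (comp_of_set P) i = (inord i.+1 \in P).
Proof. by rewrite /desc mem_comp_of_set -ltn_predRL ltn_ord. Qed.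

Lemma mem_descents_symdiff alpha x : (x < n)%N ->
  (inord x.+1 \in descents_symdiff n alpha) =
  (x.+1 \in descents alpha) (+) (x \in descents alpha).
Proof.
by move=> xn; rewrite inE inordK ?ltnS // (mem_map succn_inj).
Qed.

Lemma peak_ord P (x : 'I_n.+1) : is_peak_set P -> x \in P ->
  exists i i', [/\ i = i'.+1 :> nat, x = i.+1 :> nat, inord i.+1 \in P
    & inord i'.+1 \notin P].
Proof.
case/peak_setP => h1 h2 xP; have /andP[x1 xn] := h1 x xP.
have i_lt : (x.-1 < n.-1)%N by lia.
have i'_lt : (x.-2 < n.-1)%N by lia.
exists (Ordinal i_lt), (Ordinal i'_lt) => /=.
have xE : x.-1.+1 = x by rewrite prednK //; lia.
split; [lia | by rewrite xE | by rewrite xE inord_val |].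
by apply/negP => /(h2 _ _ xP); rewrite inordK; lia.
Qed.

(** Each i prescribes one bit of E, at [lo i] if i+1 is in P and at [hi i] otherwise. A site j
    receives two prescriptions exactly when j+1 is a peak in P, and they agree iff just one of j and
    j+1 is in D(alpha). *)
Lemma exists_compat P alpha : is_peak_set P ->
  [exists E, compat (@desc n alpha) (comp_of_set P) E] =
  (P \subset descents_symdiff n alpha).
Proof.
move=> hP; have [_ h2] := peak_setP hP.
apply/existsP/subsetP => [[E /forallP hE] x xP|hsub].
  have [i [i' [ii' xi iP i'P]]] := peak_ord hP xP.
  have xn : (i < n)%N by apply: leq_trans (ltn_ord i) (leq_pred n).
  have -> : x = inord i.+1 by apply: val_inj; rewrite /= xi inordK.
  rewrite mem_descents_symdiff // -/(desc alpha i) ii' -/(desc alpha i').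
  have /eqP := hE i; have /eqP := hE i'.
  rewrite /diag_char !desc_comp_of_set iP (negPf i'P).
  have -> : hi i' = lo i by apply: val_inj.
  by move=> <- <-; case: (E _).
exists [ffun j : 'I_n => if inord j.+1 \in P then j.+1 \notin descents alpha
                         else nat_of_ord j \in descents alpha].
apply/forallP => i; apply/eqP; rewrite /diag_char !ffunE desc_comp_of_set /=.
case: ifP => iP; first by rewrite iP negbK.
case: ifP => // jP; have := hsub _ jP; rewrite mem_descents_symdiff ?hi_proof //.
by rewrite /desc; case: (_ \in _); case: (_ \in _).
Qed.

End PeakCombinatorics.

(** Let y be the least element in which P and Q differ. Then y-1 is not in the one containing y, as
    that is a peak set, nor in the other by minimality: this is the common non-descent of
    [eigen_cmod_eq0]. *)
Lemma ind_simple_hom0 (K : fieldType) n (P Q : {set 'I_n.+1}) : is_peak_set P -> is_peak_set Q ->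
  P != Q ->
  forall f : {linear Ind (hecke_simple K n (comp_of_set P)) ->
                     Ind (hecke_simple K n (comp_of_set Q))},
  forall x, f x = 0.
Proof.
move=> hP hQ PQ f x; suff E0 : f (eta K n _) = 0.
  by rewrite (@ind_simple_ext _ _ _ _ f \0%R) // E0.
have [x0 hx0] : exists x, x \in (P :\: Q) :|: (Q :\: P).
  apply/set0Pn; apply: contra PQ => /eqP/setP h; apply/eqP/setP => y.
  by have := h y; rewrite !inE; case: (y \in P); case: (y \in Q).
have [y hy ymin] := @arg_minnP _ x0 (mem ((P :\: Q) :|: (Q :\: P))) val hx0.
have same (z : 'I_n.+1) : (z < y)%N -> (z \in P) = (z \in Q).
  move=> zy; have : z \notin (P :\: Q) :|: (Q :\: P).
    by apply: contraL zy => /ymin; rewrite -leqNgt.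
  by rewrite !inE; case: (z \in P); case: (z \in Q).
have [i [i' [ii' yi i'P]]] : exists i i' : 'I_n.-1,
    [/\ i = i'.+1 :> nat, y = i.+1 :> nat & ~~ ((inord i'.+1 \in P) || (inord i'.+1 \in Q))].
  move: (hy); rewrite !inE => /orP[] /andP[_ yP].
    have [i [i' [ii' yi _ i'P]]] := peak_ord hP yP; exists i, i'; split=> //.
    rewrite (negPf i'P) /= -same // inordK ?yi ?ii' //.
    by rewrite ltnS -ii' ltnW // (leq_trans (ltn_ord i)) // leq_pred.
  have [i [i' [ii' yi _ i'P]]] := peak_ord hQ yP; exists i, i'; split=> //.
  rewrite (negPf i'P) orbF same // inordK ?yi ?ii' //.
  by rewrite ltnS -ii' ltnW // (leq_trans (ltn_ord i)) // leq_pred.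
case/norP: i'P => i'P i'Q.
apply: to_cmod_eq0; apply: (@eigen_cmod_eq0 _ _ _ (comp_of_set P) _ i i') => //.
- by do 2!apply: eigen_lin; apply: eta_eigen.
- by rewrite desc_comp_of_set (negPf i'Q).
- by rewrite desc_comp_of_set (negPf i'P).
rewrite !desc_comp_of_set -yi inord_val; move: hy; rewrite !inE.
by case: (_ \in _); case: (_ \in _).
Qed.

(** * The idempotent given by a projective cover *)

Section CoverIdempotent.
Variables (K : fieldType) (n : nat) (alpha : seq nat).
Notation H := (hecke K n).
Variable P : lmodType H.
Hypothesis Pcover : projective_cover P (hecke_simple K n alpha).

Lemma cover_idempotent : exists (p : P) (s : {linear P -> H^o}),
  [/\ forall z, (s z : H) *: p = z,
      s p * s p = s p :> H
    & forall beta, hecke_char K n beta (s p : H) =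
        ([forall i : 'I_n.-1, desc beta i == desc alpha i])%:R].
Proof.
have [Pproj [f fsurj fess]] := Pcover.
have scaleE beta (h : H) (x : hecke_simple K n beta) :
  h *: x = (hecke_char K n beta h * (x : K)) :> K by [].
have [p fp] := fsurj (1 : K).
have genl (q : P) : linear (fun h : H^o => (h : H) *: q).
  by move=> a x y; rewrite scalerDl [in LHS]/GRing.scale /= scalerA.
pose gen q := mklin (genl q).
have gensurj q : (f q : K) != 0 -> surj (gen q).
  move=> fq; apply: fess => x; exists (pscal _ ((x : K) / (f q : K))).
  rewrite /= mklinE linearZ /= scaleE hecke_char_k.
  by rewrite mulfVK.
have psurj : surj (gen p) by apply: gensurj; rewrite fp oner_eq0.
have [s sE] := Pproj _ _ (gen p) idfun psurj.
have sp z : (s z : H) *: p = z by have := sE z; rewrite mklinE.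
exists p, s; split=> // [|beta].
  by have := linearZZ s (s p : H) p; rewrite sp => /esym.
have charp beta' : hecke_char K n beta' (s p) * hecke_char K n beta' (s p) =
    hecke_char K n beta' (s p).
  rewrite -rmorphM; congr (hecke_char _ _ _ _).
  by have := linearZZ s (s p : H) p; rewrite sp => /esym.
case: forallP => [h|h].
  have -> : hecke_char K n beta (s p) = hecke_char K n alpha (s p).
    by apply: hecke_char_desc => i; apply/eqP.
  have := linearZZ f (s p : H) p; rewrite sp fp scaleE mulr1; exact: esym.
apply/eqP/negPn/negP => c0.
have {charp} c1 : hecke_char K n beta (s p) = 1.
  by apply: (mulfI c0); rewrite charp mulr1.
have /forallPn[i di] : ~~ [forall i : 'I_n.-1, desc beta i == desc alpha i].
  exact/forallP.
(* [t] vanishes under the character of beta but not under that of alpha. So [t *: p] still generates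
   P, and s p = u t (s p) has value 0 at beta. *)
pose t : H := pgen K (@hecke_rels n) i - pscal _ (chi K (desc beta i)).
have tsurj : surj (gen (t *: p)).
  apply: gensurj; rewrite linearZ /= scaleE fp mulr1.
  rewrite /t rmorphB hecke_char_T hecke_char_k /chi.
  by move: di; case: desc; case: desc; rewrite //= ?subr0 ?opprK ?sub0r ?add0r ?oppr_eq0 oner_eq0.
have [u] := tsurj p; rewrite mklinE scalerA => up.
have sl := linearZZ s (u * t) p; rewrite up in sl.
have : hecke_char K n beta (s p) = 0.
  rewrite sl [X in hecke_char _ _ _ X](_ : _ = u * t * s p) // !rmorphM.
  by rewrite /t rmorphB hecke_char_T hecke_char_k subrr mulr0 mul0r.
by move/eqP; rewrite c1 oner_eq0.
Qed.

End CoverIdempotent.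

(** * Normal forms in the 0-Hecke algebra *)

Section NormalForms.
Variables (R : pzRingType) (N : nat) (t : nat -> R).
Hypothesis tsqr : forall i, (i < N)%N -> t i * t i = - t i.
Hypothesis tfar : forall i j, (i.+1 < j)%N -> (j < N)%N -> t i * t j = t j * t i.
Hypothesis tbraid : forall i, (i.+1 < N)%N ->
  t i * t i.+1 * t i = t i.+1 * t i * t i.+1.

(** Products of these increasing runs are the usual reduced words of permutations. *)
Let w k m := \prod_(k <= j < m) t j.

Let wrec k m : (k < m)%N -> w k m = t k * w k.+1 m.
Proof. exact: big_ltn. Qed.

Let w_comm i k m : (m <= N)%N -> (i < N)%N -> (i.+1 < k)%N || (m < i)%N ->
  t i * w k m = w k m * t i.
Proof.
move=> mN iN; elim: m => [|m IH] in mN *.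
  by rewrite /w big_geq // mulr1 mul1r.
move=> h; have [km|mk] := leqP k m; last by rewrite /w big_geq // mulr1 mul1r.
rewrite /w big_nat_recr //= mulrA IH; [|lia|by lia].
rewrite -!mulrA; congr (_ * _).
by case/orP: h => h; [apply: tfar; lia | apply/esym/tfar; lia].
Qed.

(** The braid relation turns t_(i+1) t_i t_(i+1) into t_i t_(i+1) t_i; t_(i+1) commutes with the
    factors before and t_i with those after. *)
Let w_slide i k m : (m <= N)%N -> (k <= i)%N -> (i.+1 < m)%N ->
  t i.+1 * w k m = w k m * t i.
Proof.
move=> mN ki im; rewrite /w (@big_cat_nat _ _ _ i) //=; last by lia.
rewrite -!/(w _ _) [w i m]wrec 1?[w i.+1 m]wrec; [|lia|lia].
rewrite mulrA w_comm; [|lia|lia|lia].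
rewrite -!mulrA; congr (_ * _).
rewrite -[in RHS]w_comm; [|lia|lia|lia].
by rewrite !mulrA tbraid //; lia.
Qed.

(* The elements t_k t_(k+1) ... t_m b, with b a normal form in the first m
   generators, are stable by left multiplication up to sign. *)
Lemma hecke_normal_forms m : (m <= N)%N ->
  exists (G : nat -> R -> Prop) (B : nat), [/\ G 0 1,
    forall l h, G l h -> (l <= B)%N
  & forall l h i, G l h -> (i < m)%N -> t i * h = - h \/ G l.+1 (t i * h)].
Proof.
elim: m => [|m IH] mN.
  by exists (fun l h => l = 0%N /\ h = 1), 0%N; split=> // l h [-> _].
have [G [B [G0 GB Gt]]] := IH (ltnW mN).
exists (fun l h => exists k l' b,
  [/\ (k <= m.+1)%N, G l' b, l = (m.+1 - k + l')%N & h = w k m.+1 * b]), (m.+1 + B)%N.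
split.
- by exists m.+1, 0%N, 1; split=> //; rewrite ?subnn // /w big_geq // mulr1.
- by move=> _ _ [k [l' [b [km /GB lB -> _]]]]; lia.
move=> _ _ i [k [l' [b [km Gb -> ->]]]] im.
have shift i' : (i' < m)%N -> t i * w k m.+1 = w k m.+1 * t i' ->
    t i * (w k m.+1 * b) = - (w k m.+1 * b) \/
    (exists k0 l'0 b0, [/\ (k0 <= m.+1)%N, G l'0 b0,
       (m.+1 - k + l').+1 = (m.+1 - k0 + l'0)%N
     & t i * (w k m.+1 * b) = w k0 m.+1 * b0]).
  move=> i'm E; rewrite mulrA E -mulrA.
  case: (Gt _ _ _ Gb i'm) => [->|Gb']; first by left; rewrite mulrN.
  by right; exists k, l'.+1, (t i' * b); split=> //; rewrite addnS.
(* For i+1 < k, t_i commutes with the run; for i = k it is absorbed with a sign; for i > k it comes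
   out as t_(i-1); for i+1 = k it lengthens the run. *)
case: (ltngtP i.+1 k) => ik.
- by apply: (shift i); [lia | apply: w_comm; lia].
- have [ki|ki] := eqVneq i k.
    by left; rewrite ki wrec -?ki // !mulrA tsqr ?(leq_trans im) // !mulNr.
  case: i im ik ki shift => [|i] im ik ki shift; first by lia.
  by apply: (shift i); [lia | apply: w_slide; lia].
right; exists i, l', b; split=> //; first by lia.
  by lia.
by rewrite [w i _]wrec // ik mulrA.
Qed.

End NormalForms.

(** Take a normal form h of maximal length with h y nonzero. For each i, either T_i h = -h, or T_i h
    is longer and therefore kills y: the eigenvalue is -1 or 0. *)
Lemma exists_eigen (K : fieldType) n (Y : lmodType (hecke_clifford K n)) (y : Y) : y != 0 ->
  exists (h : hecke K n) beta, [/\ is_comp n beta, hecke_incl K n h *: y != 0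
    & eigen beta (hecke_incl K n h *: y)].
Proof.
(* The value 0 outside the range only serves the indexing by natural numbers. *)
move=> y0; pose t i : hecke K n := if insub i is Some j then pgen K (@hecke_rels n) j else 0.
have tE (i : 'I_n.-1) : t i = pgen K (@hecke_rels n) i by rewrite /t valK.
have [h1 h2 h3] : hecke_rels (pgen K (@hecke_rels n)).
  split=> [i|i j ij|i j ij]; apply: presented_ext => B m;
    rewrite !(rmorphM, rmorphN) /= !peval_gen; case: (igenP m) => [r1 r2 r3].
  - exact: r1.
  - exact: r2.
  - exact: r3.
have [|||G [B [G1 GB Gt]]] := @hecke_normal_forms _ n.-1 t _ _ _ n.-1 (leqnn _).
- by move=> i hi; rewrite (tE (Ordinal hi)) h1.
- move=> i j ij hj; have hi : (i < n.-1)%N by lia.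
  by rewrite (tE (Ordinal hi)) (tE (Ordinal hj)) h2 //= ij.
- move=> i hi1; have hi : (i < n.-1)%N by lia.
  by rewrite (tE (Ordinal hi)) (tE (Ordinal hi1)) (h3 _ (Ordinal hi1)).
suff IH k l h : G l h -> hecke_incl K n h *: y != 0 -> (B < l + k)%N ->
    exists (h : hecke K n) beta, [/\ is_comp n beta, hecke_incl K n h *: y != 0
      & eigen beta (hecke_incl K n h *: y)].
  by apply: (IH B.+1 0%N 1) => //; rewrite rmorph1 scale1r.
elim: k l h => [|k IH] l h Gh hy lk.
  by have := GB _ _ Gh; lia.
have [[i [Gi hiy]]|none] := pselect (exists i : 'I_n.-1, G l.+1 (t i * h) /\
    hecke_incl K n (t i * h) *: y != 0).
  by apply: (IH _ _ Gi hiy); lia.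
set u := _ *: y in hy.
exists h, (comp_of (fun i => hc_T K i *: u != 0)); split=> //; first exact: comp_ofP.
move=> i; rewrite desc_comp_of /chi; case: ifP => [/eqP hi|/negbT].
  rewrite rmorphN rmorph1 scaleN1r.
  have [E|Gi] := Gt _ _ i Gh (ltn_ord i).
    by rewrite /u scalerA -iota_gen -rmorphM -tE E rmorphN scaleNr.
  case: none; exists i; split=> //; apply/eqP.
  by rewrite rmorphM -scalerA tE iota_gen.
by rewrite negbK rmorph0 scale0r => /eqP.
Qed.

(** * Supermodules *)

Section Supermodules.
Variable A : superring.
Implicit Types M N X Y : supermod A.

Lemma sm_gr0 M e : sm_gr e (0 : M).
Proof. exact: (gr0 (sm_grading M)). Qed.
Lemma sm_grB M e (x y : M) : sm_gr e x -> sm_gr e y -> sm_gr e (x - y).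
Proof. exact: (grB (sm_grading M)). Qed.
Lemma sm_grD M e (x y : M) : sm_gr e x -> sm_gr e y -> sm_gr e (x + y).
Proof. exact: (grD (sm_grading M)). Qed.

Lemma sm_split M (x : M) : exists x0 x1,
  [/\ sm_gr false x0, sm_gr true x1 & x = x0 + x1].
Proof. by case: (sm_grading M). Qed.

Lemma sm_split_uniq M (x0 x1 y0 y1 : M) : sm_gr false x0 -> sm_gr true x1 ->
  sm_gr false y0 -> sm_gr true y1 -> x0 + x1 = y0 + y1 -> x0 = y0 /\ x1 = y1.
Proof.
move=> h0 h1 k0 k1 E.
have E' : x0 - y0 = y1 - x1.
  by apply/eqP; rewrite subr_eq -addrAC eq_sym subr_eq E addrC.
have /(gr_disj (sm_grading M)) D := sm_grB h0 k0.
have {D} D : x0 - y0 = 0 by apply: (D true) => //; rewrite E'; apply: sm_grB.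
split; first by apply/eqP; rewrite -subr_eq0 D.
by apply/esym/eqP; rewrite -subr_eq0 -E' D.
Qed.

Lemma even_map_split M N (f : {linear M -> N}) (x : M) (y0 y1 : N) :
  even_map f -> sm_gr false y0 -> sm_gr true y1 -> f x = y0 + y1 ->
  exists x0 x1, [/\ sm_gr false x0, sm_gr true x1, x = x0 + x1, f x0 = y0 & f x1 = y1].
Proof.
move=> fe h0 h1; have [x0 [x1 [hx0 hx1 ->]]] := sm_split x.
rewrite linearD => /(sm_split_uniq (fe _ _ hx0) (fe _ _ hx1) h0 h1)[E0 E1].
by exists x0, x1.
Qed.

Lemma sub_supermodule_ker M N (f : {linear M -> N}) : even_map f ->
  sub_supermodule (fun x => f x = 0).
Proof.
move=> fe; split=> [|x y hx hy|a x hx|x y hx hy E].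
- exact: linear0.
- by rewrite linearD hx hy addr0.
- by rewrite linearZZ hx scaler0.
have [x0 [x1 [h0 h1 E1 e0 e1]]] := even_map_split fe (sm_gr0 N false)
  (sm_gr0 N true) (etrans E (esym (addr0 _))).
by have [-> ->] := sm_split_uniq hx hy h0 h1 E1.
Qed.

Lemma sub_supermodule_im M N (f : {linear M -> N}) : even_map f ->
  sub_supermodule (fun y => exists x, f x = y).
Proof.
move=> fe; split=> [|_ _ [x <-] [y <-]|a _ [x <-]|y0 y1 h0 h1 [x E]].
- by exists 0; apply: linear0.
- by exists (x + y); rewrite linearD.
- by exists (a *: x); rewrite linearZZ.
have [x0 [x1 [_ _ _ e0 e1]]] := even_map_split fe h0 h1 E.
by split; [exists x0 | exists x1].
Qed.

Lemma sub_supermoduleB M (U : M -> Prop) x y :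
  sub_supermodule U -> U x -> U y -> U (x - y).
Proof. by case=> _ UD UZ _ hx hy; apply: UD => //; rewrite -scaleN1r; apply: UZ. Qed.

Lemma simple_surj M N (f : {linear M -> N}) x : even_map f -> super_simple N ->
  f x != 0 -> surj f.
Proof.
move=> fe [_ Ns] fx y.
case: (Ns _ (sub_supermodule_im fe)) => // h.
by case/eqP: fx; apply: h; exists x.
Qed.

Lemma simple_inj M N (f : {linear M -> N}) x : even_map f -> super_simple M ->
  f x != 0 -> forall y, f y = 0 -> y = 0.
Proof.
move=> fe [_ Ms] fx y fy.
case: (Ms _ (sub_supermodule_ker fe)) => [h|h]; first exact: h.
by case/eqP: fx; apply: h.
Qed.

Lemma linear_inj (M N : lmodType A) (f : {linear M -> N}) :
  (forall x, f x = 0 -> x = 0) -> injective f.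
Proof.
move=> f0 x y E; apply/eqP; rewrite -subr_eq0; apply/eqP/f0.
by rewrite linearB; apply/eqP; rewrite subr_eq0; apply/eqP.
Qed.

Lemma linear_right_inverse (M N : lmodType A) (f : {linear M -> N}) :
  (forall x, f x = 0 -> x = 0) -> surj f ->
  exists g : {linear N -> M}, cancel g f /\ cancel f g.
Proof.
move=> /linear_inj fi /choice[g gE].
have gL : linear g by move=> a x y; apply: fi; rewrite linearP !gE.
exists (mklin gL); split=> x; first by rewrite mklinE.
by apply: fi; rewrite mklinE gE.
Qed.

Lemma bijective_linear (M N : lmodType A) (f : {linear M -> N}) :
  (forall x, f x = 0 -> x = 0) -> surj f -> bijective f.
Proof.
by move=> /linear_right_inverse h /h[g [gf fg]]; exists g.
Qed.

(** The identity map; the match is needed because [parity_if b M] does not reduce for a variable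
    [b]. *)
Definition pin b M : {linear M -> parity_if b M} :=
  match b return {linear M -> parity_if b M} with
  | true => (idfun : {linear M -> M}) | false => (idfun : {linear M -> M}) end.
Definition pout b M : {linear parity_if b M -> M} :=
  match b return {linear parity_if b M -> M} with
  | true => (idfun : {linear M -> M}) | false => (idfun : {linear M -> M}) end.

Lemma pinK b M : cancel (pin b M) (pout b M). Proof. by case: b. Qed.
Lemma poutK b M : cancel (pout b M) (pin b M). Proof. by case: b. Qed.

Lemma pin_gr b M e x : sm_gr e x -> sm_gr (e (+) b) (pin b M x).
Proof. by case: b => /=; rewrite ?addbF // addbT /parity_gr negbK. Qed.
Lemma pout_gr b M e x : sm_gr e x -> sm_gr (e (+) b) (pout b M x).
Proof. by case: b x => x /=; rewrite ?addbF // addbT. Qed.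

Lemma simple_parity_if b M : super_simple M -> super_simple (parity_if b M).
Proof.
case: b => // -[Mn Ms]; split=> // U [U0 UD UZ Us]; apply: Ms; split=> // x y hx hy.
by rewrite addrC => /(Us _ _ hy hx)[].
Qed.

Lemma fg_parity_if b M : finitely_generated M -> finitely_generated (parity_if b M).
Proof. by case: b. Qed.

Lemma even_parity M N (f : M -> N) : even_map f ->
  @even_map _ (parity M) (parity N) f.
Proof. by move=> fe e x hx; apply: fe. Qed.

Lemma projective_parity_if b M : super_projective M -> super_projective (parity_if b M).
Proof.
case: b => // -[Mfg Mp]; split=> // N N' g f Nfg Nfg' ge fe gs.
have fe' : @even_map _ M (parity N') f.
  by move=> e x hx; apply: (fe (~~ e)); rewrite /= /parity_gr negbK.
have [h he hE] := Mp (parity N) (parity N') g f Nfg Nfg' (even_parity ge) fe' gs.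
by exists h => // e x /he; rewrite /= /parity_gr negbK.
Qed.

(* When X is simple, this is what a surjection with superfluous kernel gives;
   it does not quantify over supermodules. *)
Definition essential_gen M X (f : {linear M -> X}) :=
  forall e (u : M), sm_gr e u -> f u != 0 -> forall x, exists a : A, x = a *: u.

Definition regular_gr (e : bool) (a : A^o) : Prop := sr_gr e (a : A).
Definition regular_supermod : supermod A :=
  @Supermod A A^o regular_gr (sr_grading A) (@sr_mul A).

Lemma fg_regular : finitely_generated regular_supermod.
Proof.
by exists 1%N, (fun=> 1 : A) => x; exists (fun=> x : A); rewrite big_ord1 [RHS]mulr1.
Qed.

Lemma cover_parity_if b M X : super_projective_cover M X -> super_simple X ->
  super_projective (parity_if b M) /\ exists f : {linear parity_if b M -> parity_if b X},
    [/\ even_map f, surj f & essential_gen f].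
Proof.
move=> [Mp [f [fe fs fess]]] Xs; split; first exact: projective_parity_if.
have gen e (u : M) : sm_gr e u -> f u != 0 -> forall x, exists a : A, x = a *: u.
  move=> hu top_proj x.
  have aL : linear (fun a : A^o => (a : A) *: u).
    by move=> a y z; rewrite scalerDl [in LHS]/GRing.scale /= scalerA.
  (* The shift by the degree of u makes a |-> a u even. *)
  pose R := parity_if e regular_supermod.
  pose g : {linear R -> M} := mklin aL \o pout e regular_supermod.
  have ge : even_map g.
    move=> d a ha; rewrite /g /= mklinE.
    have : sm_gr (d (+) e) (pout e regular_supermod a) := pout_gr ha.
    by move=> h; rewrite -[d](addbK e); apply: sm_act.
  have := fess _ g (fg_parity_if e fg_regular) ge.
  have fgs : surj (f \o g).
    apply: (@simple_surj _ _ (f \o g : {linear R -> X}) (pin e regular_supermod (1 : A))) => //.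
      by move=> d a ha; apply/fe/ge.
    by rewrite /= pinK mklinE scale1r.
  by move=> /(_ fgs x)[a <-]; exists (pout e regular_supermod a); rewrite /g /= mklinE.
exists (pin b X \o f \o pout b M); split.
- move=> e x /pout_gr/fe/pin_gr h.
  by move: (h b); rewrite addbK.
- move=> y; have [x hx] := fs (pout b X y); exists (pin b M x).
  by rewrite /= pinK hx poutK.
move=> e u hu top_proj x.
have [||a ha] := @gen (e (+) b) (pout b M u) _ _ (pout b M x).
- exact: pout_gr.
- by apply: contraNneq top_proj => /= ->; rewrite linear0.
by exists a; rewrite -[x]poutK ha linearZZ poutK.
Qed.

(** * Maps into and out of direct sums *)

Section DsumMaps.
Variables (I : finType) (X : I -> supermod A).
Implicit Types (i j : I).

Definition dinj_fun i (x : X i) : dsum X :=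
  [ffun j => dfwith (fun j => 0 : X j) x j].

Lemma dinj_in i (x : X i) : (dinj_fun x : dsum_car X) i = x.
Proof. by rewrite ffunE dfwith_in. Qed.

Lemma dinj_out i j (x : X i) : i != j -> (dinj_fun x : dsum_car X) j = 0.
Proof. by move=> ij; rewrite ffunE dfwith_out. Qed.

Fact dinj_linear i : linear (@dinj_fun i).
Proof.
move=> a x y; apply/ffunP => j; rewrite [RHS]ffunE [in RHS]ffunE.
have [<-|ij] := eqVneq i j; first by rewrite !dinj_in.
by rewrite !dinj_out // scaler0 addr0.
Qed.
Definition dinj i : {linear X i -> dsum X} := mklin (@dinj_linear i).

Fact dproj_linear i : linear (fun t : dsum X => (t : dsum_car X) i).
Proof. by move=> a x y; rewrite ffunE [in LHS]ffunE. Qed.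
Definition dproj i : {linear dsum X -> X i} := mklin (@dproj_linear i).

Lemma dproj_dinj i x : dproj i (dinj i x) = x.
Proof. by rewrite !mklinE dinj_in. Qed.

Lemma dproj_dinj0 i j x : i != j -> dproj j (dinj i x) = 0.
Proof. by move=> ij; rewrite !mklinE dinj_out. Qed.

Lemma dsum_ext (s t : dsum X) : (forall i, dproj i s = dproj i t) -> s = t.
Proof. by move=> h; apply/ffunP => i; have := h i; rewrite !mklinE. Qed.

Lemma dsumE (t : dsum X) : t = \sum_i dinj i (dproj i t).
Proof.
apply: dsum_ext => i; rewrite linear_sum (bigD1 i) //= dproj_dinj big1 ?addr0 //.
by move=> j ji; apply: dproj_dinj0.
Qed.

Lemma dproj_even i : even_map (dproj i).
Proof. by move=> e x hx; rewrite mklinE; apply: hx. Qed.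

Lemma dinj_even i : even_map (dinj i).
Proof.
move=> e x hx j; rewrite mklinE; have [<-|ij] := eqVneq i j.
  by rewrite dinj_in.
by rewrite dinj_out //; apply: sm_gr0.
Qed.

Lemma dsum_gr_proj e (t : dsum X) : (forall i, sm_gr e (dproj i t)) -> sm_gr e t.
Proof. by move=> h i; have := h i; rewrite mklinE. Qed.

Fact dmap_linear M (f : forall i, {linear M -> X i}) :
  linear (fun x => [ffun i => f i x] : dsum X).
Proof. by move=> a x y; apply/ffunP => i; rewrite !ffunE linearP. Qed.
Definition dmap M (f : forall i, {linear M -> X i}) : {linear M -> dsum X} :=
  mklin (dmap_linear f).

Lemma dproj_dmap M (f : forall i, {linear M -> X i}) i x : dproj i (dmap f x) = f i x.
Proof. by rewrite !mklinE ffunE. Qed.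

Fact dcomap_linear (Y : lmodType A) (f : forall i, {linear X i -> Y}) :
  linear (fun t : dsum X => \sum_i f i (dproj i t)).
Proof.
move=> a x y; rewrite scaler_sumr -big_split; apply: eq_bigr => i _.
by rewrite !linearP.
Qed.
Definition dcomap (Y : lmodType A) (f : forall i, {linear X i -> Y}) :
  {linear dsum X -> Y} := mklin (dcomap_linear f).

Lemma dcomap_dinj (Y : lmodType A) (f : forall i, {linear X i -> Y}) i x :
  dcomap f (dinj i x) = f i x.
Proof.
rewrite mklinE (bigD1 i) //= dproj_dinj big1 ?addr0 // => j ji.
by rewrite dproj_dinj0 1?eq_sym // linear0.
Qed.

(** Summands are added one at a time. The image under f v of the common kernel of the previous maps
    is all of X v, and surjectivity persists, or it is 0, and f v factors through the previous maps:
    this relation is [theta]. *)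
Lemma joint_surj M (f : forall i, {linear M -> X i}) :
  (forall i, super_simple (X i)) -> (forall i, even_map (f i)) ->
  ~ surj (dmap f) ->
  exists v (theta : {linear dsum X -> X v}),
    (forall x, theta (dmap f x) = 0) /\ forall x, theta (dinj v x) = x.
Proof.
move=> Xs fe nsurj; apply: contrapT => nex; apply: nsurj => t.
suff [x hx] : exists x, forall i, i \in enum I -> f i x = dproj i t.
  by exists x; apply: dsum_ext => i; rewrite dproj_dmap hx ?mem_enum.
move: t (enum_uniq I); elim: (enum I) => [|v s IH] t; first by exists 0.
case/andP => vs us.
pose U (y : X v) := exists x, (forall i, i \in s -> f i x = 0) /\ f v x = y.
have Usub : sub_supermodule U.
  split=> [|_ _ [x [xs <-]] [y [ys <-]]|a _ [x [xs <-]]|y0 y1 h0 h1 [x [xs E]]].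
  - by exists 0; rewrite linear0; split=> // i _; rewrite linear0.
  - exists (x + y); rewrite linearD; split=> // i si.
    by rewrite linearD xs // ys // addr0.
  - exists (a *: x); rewrite linearZZ; split=> // i si.
    by rewrite linearZZ xs // scaler0.
  have [x0 [x1 [g0 g1 xE e0 e1]]] := even_map_split (fe v) h0 h1 E.
  have xs' i : i \in s -> f i x0 = 0 /\ f i x1 = 0.
    move=> /xs E'; apply: (sm_split_uniq (fe i _ _ g0) (fe i _ _ g1)
      (sm_gr0 (X i) false) (sm_gr0 (X i) true)).
    by rewrite -linearD -xE E' addr0.
  by split; [exists x0 | exists x1]; split=> // i /xs'[].
case: (Xs v) => _ /(_ U Usub)[U0|UT]; last first.
  have [x xs] := IH t us.
  have [y [ys yv]] := UT (dproj v t - f v x).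
  exists (x + y) => i; rewrite inE linearD => /orP[/eqP ->|si].
    by rewrite yv addrC subrK.
  by rewrite ys // addr0 xs.
case: nex; exists v; have /choice[sec secE] : forall t : dsum X, exists x, forall i,
    i \in s -> f i x = dproj i t by move=> t'; apply: IH.
have fv x y : (forall i, i \in s -> f i x = f i y) -> f v x = f v y.
  move=> h; apply/eqP; rewrite -subr_eq0 -linearB; apply/eqP/U0.
  by exists (x - y); split=> // i si; rewrite linearB /= h // subrr.
(* [sec] is any choice of preimages for the components in [s]; by [fv] the value f v (sec t) does
   not depend on it. *)
have thL : linear (fun t : dsum X => dproj v t - f v (sec t)).
  move=> a x y; rewrite linearP (_ : f v _ = a *: f v (sec x) + f v (sec y)).
    by rewrite scalerBr opprD addrACA.
  rewrite -linearP; apply: fv => i si.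
  by rewrite secE // !linearP /= !secE.
exists (mklin thL); split=> x; rewrite mklinE.
  by rewrite dproj_dmap (fv (sec _) x) ?subrr // => i si; rewrite secE // dproj_dmap.
rewrite dproj_dinj (fv _ 0) ?linear0 ?addr0 // => i si.
by rewrite secE // linear0 dproj_dinj0 //; apply: contraNneq vs => ->.
Qed.

(* One summand is removed from the kernel at a time, since the essential
   property only speaks of a single simple quotient. *)
Lemma dsum_essential (Y : I -> supermod A) (f : forall i, {linear X i -> Y i})
    (U : dsum X -> Prop) :
  (forall i, even_map (f i)) -> (forall i, essential_gen (f i)) ->
  (forall i, super_simple (Y i)) -> (forall i, surj (f i)) -> sub_supermodule U ->
  (forall t, exists2 u, U u & forall i, f i (dproj i u) = f i (dproj i t)) ->
  forall t, U t.
Proof.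
move=> fe fess Ys fs Us hU.
(* [V s t]: some element of U agrees with t exactly outside [s], and modulo the kernels of the f i
   inside. *)
pose V (s : seq I) (t : dsum X) := exists2 u, U u & forall i,
  f i (dproj i u) = f i (dproj i t) /\ (i \notin s -> dproj i u = dproj i t).
suff VT s : (forall t, V s t) -> forall t, U t.
  apply: (VT (enum I)) => t.
  by have [u Uu h] := hU t; exists u => // i; split=> //; rewrite mem_enum.
elim: s => [|v s IH] VvT.
  move=> t; have [u Uu h] := VvT t; have -> // : t = u.
  by apply: dsum_ext => i; have [_ ->] := h i.
have [U0 UD UZ Ugr] := Us.
have VD x y : V s x -> V s y -> V s (x + y).
  move=> [u Uu hu] [w Uw hw]; exists (u + w); first exact: UD.
  move=> i; have [u1 u2] := hu i; have [w1 w2] := hw i.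
  by rewrite !linearD u1 w1; split=> // si; rewrite u2 ?w2.
have VZ a x : V s x -> V s (a *: x).
  move=> [u Uu hu]; exists (a *: u); first exact: UZ.
  move=> i; have [u1 u2] := hu i.
  by rewrite !linearZZ u1; split=> // si; rewrite u2.
(* Take a homogeneous a with f v a nonzero and an element of U approximating [dinj v a]. Its
   component of the degree of a is in U too, and by [essential_gen] its v-th coordinate generates X
   v. *)
have Vv x : V s (dinj v x).
  have [y0 yn0] : exists y : Y v, y != 0 by case: (Ys v) => -[y hy] _; exists y.
  have [a0 fa0] := fs v y0.
  have [b0 [b1 [hb0 hb1 ab]]] := sm_split a0.
  have [e [a ha fa]] : exists e, exists2 a : X v, sm_gr e a & f v a != 0.
    have [f0|] := eqVneq (f v b0) 0; last by exists false, b0.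
    exists true, b1 => //; apply: contraNneq yn0 => f1.
    by rewrite -fa0 ab linearD f0 f1 addr0.
  have [u Uu hu] := VvT (dinj v a).
  have [u0 [u1 [hu0 hu1 uE]]] := sm_split u.
  have [Uu0 Uu1] : U u0 /\ U u1 by apply: Ugr => //; rewrite -uE.
  pose ue := if e then u1 else u0.
  have Uue : U ue by rewrite /ue; case: (e).
  have hue : sm_gr e ue by rewrite /ue; case: (e).
  have hue_proj i : i != v -> i \notin s -> dproj i ue = 0.
    move=> iv si; have [_] := hu i; rewrite inE negb_or iv si => /(_ isT).
    rewrite dproj_dinj0 1?eq_sym // uE linearD -[0 in X in X -> _]addr0.
    move/(sm_split_uniq (dproj_even i hu0) (dproj_even i hu1) (sm_gr0 _ _) (sm_gr0 _ _)).
    by rewrite /ue; case: (e) => -[].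
  have hue_f i : f i (dproj i ue) = f i (dproj i (dinj v a)).
    have [+ _] := hu i; rewrite uE linearD linearD.
    have hda := fe i _ _ (dproj_even i (dinj_even ha)).
    move: hda; rewrite /ue; case: (e) => hda E.
      rewrite -[RHS]add0r in E.
      by have [] := sm_split_uniq (fe i _ _ (dproj_even i hu0)) (fe i _ _ (dproj_even i hu1))
         (sm_gr0 _ _) hda E.
    rewrite -[RHS]addr0 in E.
    by have [] := sm_split_uniq (fe i _ _ (dproj_even i hu0)) (fe i _ _ (dproj_even i hu1))
         hda (sm_gr0 _ _) E.
  have fve : f v (dproj v ue) != 0 by rewrite hue_f dproj_dinj.
  have [r ->] := fess v e (dproj v ue) (dproj_even v hue) fve x.
  rewrite linearZZ; apply: VZ; exists ue => // i.
  have [->|iv] := eqVneq i v; first by rewrite dproj_dinj.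
  rewrite hue_f !dproj_dinj0 1?eq_sym //; split=> // si.
  exact: hue_proj.
apply: IH => t; have [u Uu hu] := VvT t.
rewrite -[t](subrK (dinj v (dproj v t - dproj v u))); apply: VD (Vv _).
exists u => // i; have [u1 u2] := hu i; rewrite linearB.
have [->|iv] := eqVneq i v; first by rewrite dproj_dinj opprB addrC subrK.
rewrite dproj_dinj0 1?eq_sym // subr0; split=> // si.
by apply: u2; rewrite inE negb_or iv.
Qed.
End DsumMaps.
End Supermodules.

Arguments dproj {A I X} i.
Arguments dinj {A I X} i.

(** * Quotient supermodules and simple quotients *)

Section QuotientSupermodule.
Local Open Scope quotient_scope.
Variables (A : superring) (M : supermod A) (U : M -> Prop).
Hypothesis Us : sub_supermodule U.

Definition qeq : rel M := fun x y => `[< U (x - y) >].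

Fact qeq_refl : reflexive qeq.
Proof. by move=> x; apply/asboolP; rewrite subrr; case: Us. Qed.
Fact qeq_sym : symmetric qeq.
Proof.
have h x y : U (x - y) -> U (y - x).
  by move=> hU; rewrite -opprB -[- _]add0r; apply: sub_supermoduleB => //; case: Us.
by move=> x y; apply/asboolP/asboolP; apply: h.
Qed.
Fact qeq_trans : transitive qeq.
Proof.
move=> y x z /asboolP xy /asboolP yz; apply/asboolP.
by have [_ UD _ _] := Us; rewrite -(subrKA y); apply: UD.
Qed.
Canonical qeq_equiv := EquivRel qeq qeq_refl qeq_sym qeq_trans.

Definition quot := {eq_quot qeq}.
HB.instance Definition _ := Choice.on quot.
Implicit Types x y z : quot.

Definition qpi (u : M) : quot := \pi_quot u.

Lemma qpi_eq u v : qpi u = qpi v <-> U (u - v).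
Proof.
split=> [/eqP|h]; first by rewrite eqmodE => /asboolP.
by apply/eqP; rewrite eqmodE; apply/asboolP.
Qed.

Lemma qpi_repr u : U (repr (qpi u) - u).
Proof. by apply/qpi_eq; apply: reprK. Qed.

Lemma qpiP x : exists u, x = qpi u.
Proof. by exists (repr x); rewrite /qpi reprK. Qed.

Definition qzero : quot := qpi 0.
Definition qopp x : quot := qpi (- repr x).
Definition qadd x y : quot := qpi (repr x + repr y).
Definition qscale (a : A) x : quot := qpi (a *: repr x).

Lemma qoppE u : qopp (qpi u) = qpi (- u).
Proof.
apply/qpi_eq; have [_ _ UZ _] := Us.
by rewrite -opprD -[- (_ - _)]scaleN1r; apply: UZ; apply: qpi_repr.
Qed.
Lemma qaddE u v : qadd (qpi u) (qpi v) = qpi (u + v).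
Proof.
apply/qpi_eq; have [_ UD _ _] := Us.
by rewrite opprD addrACA; apply: UD; apply: qpi_repr.
Qed.
Lemma qscaleE a u : qscale a (qpi u) = qpi (a *: u).
Proof.
apply/qpi_eq; have [_ _ UZ _] := Us.
by rewrite -scalerBr; apply: UZ; apply: qpi_repr.
Qed.
Let qE := (qoppE, qaddE, qscaleE).

Fact qaddA : associative qadd.
Proof.
by move=> x y z; have [u ->] := qpiP x; have [v ->] := qpiP y;
  have [w ->] := qpiP z; rewrite !qE addrA.
Qed.
Fact qaddC : commutative qadd.
Proof. by move=> x y; have [u ->] := qpiP x; have [v ->] := qpiP y; rewrite !qE addrC. Qed.
Fact qadd0 : left_id qzero qadd.
Proof. by move=> x; have [u ->] := qpiP x; rewrite /qzero !qE add0r. Qed.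
Fact qaddN : left_inverse qzero qopp qadd.
Proof. by move=> x; have [u ->] := qpiP x; rewrite /qzero !qE addNr. Qed.
HB.instance Definition _ := GRing.isZmodule.Build quot qaddA qaddC qadd0 qaddN.

Fact qscaleA a b x : qscale a (qscale b x) = qscale (a * b) x.
Proof. by have [u ->] := qpiP x; rewrite !qE scalerA. Qed.
Fact qscale1 : left_id 1 qscale.
Proof. by move=> x; have [u ->] := qpiP x; rewrite !qE scale1r. Qed.
Fact qscaleDr : right_distributive qscale +%R.
Proof.
move=> a x y; have [u ->] := qpiP x; have [v ->] := qpiP y.
by rewrite -[LHS]/(qscale a (qadd _ _)) -[RHS]/(qadd _ _) !qE scalerDr.
Qed.
Fact qscaleDl x : {morph qscale^~ x : a b / a + b}.
Proof.
move=> a b; have [u ->] := qpiP x.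
by rewrite -[RHS]/(qadd _ _) !qE scalerDl.
Qed.
HB.instance Definition _ := GRing.Zmodule_isLmodule.Build A quot
  qscaleA qscale1 qscaleDr qscaleDl.

Fact qpi_linear : linear qpi.
Proof. by move=> a u v; rewrite -[RHS]/(qadd (qscale _ _) _) !qE. Qed.
Definition qproj : {linear M -> quot} := mklin qpi_linear.

Lemma qproj_eq0 u : qproj u = 0 <-> U u.
Proof. by rewrite mklinE -[0]/(qpi 0) qpi_eq subr0. Qed.

Lemma qproj_surj : surj qproj.
Proof. by move=> x; have [u ->] := qpiP x; exists u; rewrite mklinE. Qed.

Definition quot_gr (e : bool) x : Prop := exists2 u, sm_gr e u & x = qproj u.

Fact quot_grading : is_grading quot_gr.
Proof.
split=> [e|e _ _ [u hu ->] [v hv ->]|x|_ [u hu ->] [v hv E]].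
- by exists 0; rewrite ?linear0 //; apply: sm_gr0.
- by exists (u - v); rewrite ?linearB //; apply: sm_grB.
- have [u <-] := qproj_surj x; have [u0 [u1 [h0 h1 ->]]] := sm_split u.
  by exists (qproj u0), (qproj u1); split; [exists u0 | exists u1 | rewrite linearD].
apply/qproj_eq0; have [_ _ _ Ugr] := Us.
have hv' : sm_gr true (- v) by rewrite -[- v]add0r; apply: sm_grB => //; apply: sm_gr0.
have /(Ugr _ _ hu hv')[] // : U (u - v).
by apply/qproj_eq0; rewrite linearB; apply/eqP; rewrite subr_eq0; apply/eqP.
Qed.

Fact quot_act d e (a : A) x : sr_gr d a -> quot_gr e x -> quot_gr (d (+) e) (a *: x).
Proof. by move=> ha [u hu ->]; exists (a *: u); rewrite ?linearZZ //; apply: sm_act. Qed.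

Definition quot_supermod : supermod A := Supermod quot_grading quot_act.
Definition quot_proj : {linear M -> quot_supermod} := qproj.

Lemma quot_proj_even : even_map quot_proj.
Proof. by move=> e u hu; exists u. Qed.

End QuotientSupermodule.

Section MaximalQuotient.
Variables (A : superring) (M : supermod A) (n0 : M).
Hypothesis n0_gen : forall x, exists a : A, x = a *: n0.

(** Zorn's lemma: the union of a chain of subsupermodules avoiding n0 still avoids n0. *)
Lemma maximal_sub_supermodule (U : M -> Prop) : sub_supermodule U -> ~ U n0 ->
  exists W, [/\ sub_supermodule W, ~ W n0, forall x, U x -> W x
    & forall W' : M -> Prop, sub_supermodule W' -> (forall x, W x -> W' x) ->
        ~ W' n0 -> forall x, W' x -> W x].
Proof.
move=> Us Un.
pose T := {W : M -> Prop | [/\ sub_supermodule W, ~ W n0 & forall x, U x -> W x]}.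
pose R : rel T := fun W W' => `[< forall x, sval W x -> sval W' x >].
have RP W W' : reflect (forall x, sval W x -> sval W' x) (R W W') by apply: asboolP.
pose t0 : T := exist _ U (And3 Us Un (fun x h => h)).
have [W Wmax] : exists W, classical_sets.premaximal R W.
  apply: (classical_sets.ZL_preorder t0) => [W|W1 W2 W3 /RP h /RP h'|C Ctot].
  - by apply/RP.
  - by apply/RP => x /h/h'.
  (* The empty chain is bounded by U itself. *)
  have [[W0 CW0]|Cn] := pselect (exists W, C W); last first.
    by exists t0 => W CW; case: Cn; exists W.
  pose X x := exists2 W, C W & sval W x.
  have Xs : [/\ sub_supermodule X, ~ X n0 & forall x, U x -> X x].
    split=> [|[W CW]|x Ux]; last 2 first.
    - by have [_ h _] := svalP W => /h.
    - by exists W0 => //; have [_ _] := svalP W0; apply.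
    split=> [|x y [W1 C1 h1] [W2 C2 h2]|a x [W CW hW]|x y hx hy [W CW hW]].
    - by exists W0 => //; have [[]] := svalP W0.
    - case: (Ctot _ _ C1 C2) => /RP h.
        by exists W2 => //; have [[_ WD _ _] _ _] := svalP W2; apply: WD => //; apply: h.
      by exists W1 => //; have [[_ WD _ _] _ _] := svalP W1; apply: WD => //; apply: h.
    - by exists W => //; have [[_ _ WZ _] _ _] := svalP W; apply: WZ.
    have [[_ _ _ Wg] _ _] := svalP W; have [Wx Wy] := Wg _ _ hx hy hW.
    by split; exists W.
  by exists (exist _ X Xs) => W CW; apply/RP => x hx; exists W.
exists (sval W); have [Ws Wn UW] := svalP W; split=> // W' W's WW' W'n x W'x.
have W'T : [/\ sub_supermodule W', ~ W' n0 & forall x, U x -> W' x].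
  by split=> // y /UW/WW'.
pose W1 : T := exist _ W' W'T.
by have /RP/(_ x W'x) := Wmax W1 (introT (RP W W1) WW').
Qed.

Lemma exists_simple_quotient (U : M -> Prop) : sub_supermodule U -> ~ U n0 ->
  exists (Y : supermod A) (q : {linear M -> Y}), [/\ super_simple Y, even_map q,
    surj q & forall x, U x -> q x = 0].
Proof.
move=> Us Un; have [W [Ws Wn UW Wmax]] := maximal_sub_supermodule Us Un.
exists (quot_supermod Ws), (quot_proj Ws); split.
- split.
    exists (quot_proj Ws n0); apply/eqP => h; apply: Wn.
    exact/(qproj_eq0 Ws).
  move=> V [V0 VD VZ Vg].
  have Vs : sub_supermodule (fun x => V (quot_proj Ws x)).
    split=> [|x y hx hy|a x hx|x y hx hy].
    - by rewrite linear0.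
    - by rewrite linearD; apply: VD.
    - by rewrite linearZZ; apply: VZ.
    by rewrite linearD; apply: Vg; apply: quot_proj_even.
  have [Vn|Vn] := pselect (V (quot_proj Ws n0)).
    right=> x; have [u <-] := @qproj_surj _ _ _ Ws x.
    by have [a ->] := n0_gen u; rewrite linearZZ; apply: VZ.
  left=> x; have [u <-] := @qproj_surj _ _ _ Ws x => Vu.
  apply/(qproj_eq0 Ws); apply: (Wmax _ Vs) => // y Wy.
  by have /(qproj_eq0 Ws) E := Wy; rewrite /= /quot_proj E.
- exact: quot_proj_even.
- exact: (@qproj_surj _ _ _ Ws).
by move=> x /UW hx; apply/(qproj_eq0 Ws).
Qed.

End MaximalQuotient.

(** * The top of the induced projective module *)

Section Blocks.
Variables (K : fieldType) (n : nat).
Notation A := (hecke_clifford K n).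
Notation S beta := (Ind (hecke_simple K n beta)).

(* Up to parity, the [pi j] and the [mu j] are the projections and inclusions of
   a decomposition of [M] into copies of [X]. *)
Definition block (M X : supermod A) (J : finType)
    (d : (J -> bool) * ((J -> {linear M -> X}) * (J -> {linear X -> M}))) :=
  let: (eps, (pi, mu)) := d in
  [/\ forall j x, pi j (mu j x) = x,
      forall j k x, j != k -> pi k (mu j x) = 0,
      forall s, s = \sum_j mu j (pi j s),
      forall j e s, sm_gr e s -> sm_gr (e (+) eps j) (pi j s)
    & forall j e x, sm_gr e x -> sm_gr (e (+) eps j) (mu j x)].

Lemma exists_block (M X : supermod A) (J : finType) :
  superiso_dsum M (fun _ : J => X) -> exists d, @block M X J d.
Proof.
case=> eps [f fe [g fK gK]].
have gL : linear g by move=> a x y; apply: (can_inj fK); rewrite linearP !gK.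
pose h := mklin gL.
have hE x : h x = g x by rewrite mklinE.
(* The inverse of an even bijection is even: the component of g x in the other degree maps to 0. *)
have he : even_map h.
  move=> e x hx; rewrite hE.
  have [x0 [x1 [h0 h1 E]]] := sm_split (g x).
  have := gK x; rewrite E linearD => fx.
  have {}hx : sm_gr e (f x0 + f x1) by rewrite fx.
  case: e hx => hx.
    have [] := sm_split_uniq (fe _ _ h0) (fe _ _ h1) (sm_gr0 _ false) hx (esym (add0r _)).
    by rewrite -(linear0 f) => /(can_inj fK) -> _; rewrite add0r.
  have [] := sm_split_uniq (fe _ _ h0) (fe _ _ h1) hx (sm_gr0 _ true) (esym (addr0 _)).
  by rewrite -(linear0 f) => _ /(can_inj fK) ->; rewrite addr0.
exists (eps, (fun j => pout (eps j) X \o dproj j \o f : {linear M -> X},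
              fun j => h \o dinj j \o pin (eps j) X : {linear X -> M})); split.
- by move=> j x; rewrite /= hE gK dproj_dinj pinK.
- by move=> j k x jk; rewrite /= hE gK dproj_dinj0 // linear0.
- move=> s; rewrite -[LHS]fK -hE {1}[f s]dsumE linear_sum.
  by apply: eq_bigr => j _; rewrite /= poutK.
- by move=> j e s hs; apply/pout_gr/dproj_even/fe.
by move=> j e x hx; apply/he/dinj_even/pin_gr.
Qed.

End Blocks.

Section InducedCover.
Variables (K : fieldType) (n : nat) (P : lmodType (hecke K n)).
Variables (p : P) (s : {linear P -> (hecke K n)^o}).
Hypothesis sp : forall z, (s z : hecke K n) *: p = z.
Notation A := (hecke_clifford K n).
Notation N := (Ind P).
Notation iota := (hecke_incl K n).
Notation eA := (iota (s p : hecke K n)).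

Definition ind_gen : N := tpure iota 1 p.

Lemma ind_gen_even : sm_gr false ind_gen.
Proof. exact: tpure_even. Qed.

Lemma ind_gen_idem : eA *: ind_gen = ind_gen.
Proof. by rewrite /ind_gen -tpureZ sp. Qed.

Lemma tpure_gen z : tpure iota 1 z = iota (s z : hecke K n) *: ind_gen :> N.
Proof. by rewrite /ind_gen -tpureZ sp. Qed.

Lemma ind_genP (x : N) : exists a : A, x = a *: ind_gen.
Proof.
rewrite [x]tensorE; apply: (big_ind (fun x : N => exists a : A, x = a *: ind_gen))
  => [|_ _ [a ->] [b ->]|[a z] _ /=].
- by exists 0; rewrite scale0r.
- by exists (a + b); rewrite scalerDl.
exists (a * iota (s z : hecke K n)).
by rewrite -scalerA -tpure_gen tpure_scale mulr1.
Qed.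

Section Lift.
Variables (Y : lmodType A) (x : Y).
Let f (z : P) : Y := iota (s z : hecke K n) *: x.

Fact cover_lift_add y z : f (y + z) = f y + f z.
Proof. by rewrite /f linearD [iota _]rmorphD scalerDl. Qed.
Fact cover_lift_scale h z : f (h *: z) = iota h *: f z.
Proof. by rewrite /f linearZZ scalerA -rmorphM. Qed.
(** Realises Hom(Ind P, Y) = e Y: for x fixed by e it sends the generator to x. *)
Definition cover_lift : {linear N -> Y} :=
  ind_lift (@hecke_incl_even K n) cover_lift_add cover_lift_scale.
Lemma cover_lift_gen : eA *: x = x -> cover_lift ind_gen = x.
Proof. by move=> ex; rewrite /cover_lift /ind_gen ind_lift_pure scale1r. Qed.
End Lift.

Lemma cover_lift_gr (Y : supermod A) (x : Y) d : eA *: x = x ->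
  sm_gr d x -> forall e z, sm_gr e z -> sm_gr (e (+) d) (cover_lift x z).
Proof.
move=> ex hx; apply: ind_even => z.
rewrite tpure_gen linearZZ cover_lift_gen // -[d]addFb.
by apply: sm_act => //; apply: hecke_incl_even.
Qed.

End InducedCover.

Section SimpleQuotients.
Variables (K : fieldType) (n : nat).
Variable HClS : {set 'I_n.+1} -> supermod (hecke_clifford K n).
Hypothesis HClS_simple : forall P : {set 'I_n.+1}, is_peak_set P -> super_simple (HClS P).
Hypothesis HClS_ind : forall beta : seq nat, is_comp n beta ->
  superiso_dsum (Ind (hecke_simple K n beta))
    (fun _ : 'I_(2 ^ peak_exp (peaks n beta)) => HClS (peaks n beta)).
Notation A := (hecke_clifford K n).
Notation S P := (Ind (hecke_simple K n (comp_of_set P))).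
Notation J P := 'I_(2 ^ peak_exp P).

Lemma peak_block P : is_peak_set P -> exists d, @block K n (S P) (HClS P) (J P) d.
Proof.
move=> hP; apply: exists_block.
by have := HClS_ind (comp_of_setP P); rewrite peaks_comp_of_set.
Qed.

(** An eigenvector makes Y a quotient of some S_beta; one of the copies of the simple supermodule in
    S_beta then maps isomorphically onto Y up to parity. *)
Lemma simple_embedding (Y : supermod A) : super_simple Y ->
  exists2 P : {set 'I_n.+1}, is_peak_set P
    & exists f : {linear Y -> S P}, forall y, f y = 0 -> y = 0.
Proof.
move=> Ys; have [y ye y0] : exists2 y : Y, exists e, sm_gr e y & y != 0.
  have [[y y0] _] := Ys; have [y1 [y2 [h1 h2 E]]] := sm_split y.
  have [z|] := eqVneq y1 0; last by exists y1 => //; exists false.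
  by exists y2; [exists true | move: y0; rewrite E z add0r].
case: ye => d yd.
have [h [beta [hbeta hy0 hyb]]] := exists_eigen y0.
pose q := simple_lift hyb.
have qE : forall e x, sm_gr e x -> sm_gr (e (+) d) (q x).
  apply: ind_even => m; rewrite [m]hecke_simple_gen tpureZ linearZZ simple_lift_eta.
  rewrite -[d]addFb; apply: sm_act; first exact: hecke_incl_even.
  by rewrite -[d]addFb; apply: sm_act => //; apply: hecke_incl_even.
have [[eps [pi mu]] [h1 h2 h3 h4 h5]] := exists_block (HClS_ind hbeta).
pose P := peaks n beta; have hP : is_peak_set P by apply: peaks_peak_set.
exists P => //.
have [j [x0 jx0]] : exists j x, q (mu j x) != 0.
  apply: contrapT => none; case/eqP: hy0; rewrite -(simple_lift_eta hyb) -/q.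
  rewrite [eta K n beta]h3 linear_sum big1 // => j _; apply/eqP/negPn/negP => qj.
  by apply: none; exists j, (pi j (eta K n beta)).
(* The shift that makes the composite even. *)
pose b := eps j (+) d.
pose t : {linear parity_if b (HClS P) -> Y} := q \o mu j \o pout b (HClS P).
have te : even_map t.
  move=> e x /(@pout_gr _ b) /(h5 j) /qE.
  suff -> : e (+) b (+) eps j (+) d = e by [].
  by rewrite /b; case: (e); case: (eps j); case: (d).
have tx0 : t (pin b _ x0) != 0 by rewrite /= pinK.
have [g [gt tg]] := linear_right_inverse
  (simple_inj te (simple_parity_if b (HClS_simple hP)) tx0) (simple_surj te Ys tx0).
(* beta has peak set P but its descent set may be larger than P, so the copy found in S_beta is
   transported to one in S_P. *)
have [[eps' [pi' mu']] [h1' _ _ _ _]] := peak_block hP.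
have j0 : J P by exists 0%N; rewrite expn_gt0.
exists (mu' j0 \o pout b (HClS P) \o g) => z /= gz.
rewrite -[z]gt -[g z](poutK (b := b)) -[pout _ _ _](h1' j0) gz.
by rewrite !linear0.
Qed.

End SimpleQuotients.

(** * The surjection onto the sum of the S_P *)

Section Top.
Variables (K : fieldType) (n : nat).
Variable HClS : {set 'I_n.+1} -> supermod (hecke_clifford K n).
Hypothesis HClS_simple : forall P : {set 'I_n.+1}, is_peak_set P -> super_simple (HClS P).
Hypothesis HClS_ind : forall beta : seq nat, is_comp n beta ->
  superiso_dsum (Ind (hecke_simple K n beta))
    (fun _ : 'I_(2 ^ peak_exp (peaks n beta)) => HClS (peaks n beta)).
Variables (alpha : seq nat) (Palpha : lmodType (hecke K n)).
Variables (p : Palpha) (s : {linear Palpha -> (hecke K n)^o}).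
Hypothesis sp : forall z, (s z : hecke K n) *: p = z.
Notation e := (s p : hecke K n).
Hypothesis ee : e * e = e.
Hypothesis eP : forall beta, hecke_char K n beta e =
  ([forall i : 'I_n.-1, desc beta i == desc alpha i])%:R.

Notation A := (hecke_clifford K n).
Notation N := (Ind Palpha).
Notation S P := (Ind (hecke_simple K n (comp_of_set P))).
Notation eA := (hecke_incl K n e).
Notation n0 := (ind_gen p).

Definition admissible : predArgType :=
  {P : {set 'I_n.+1} | is_peak_set P && (P \subset descents_symdiff n alpha)}.
Implicit Types (w : admissible).

Lemma admissible_peak w : is_peak_set (val w). Proof. by case/andP: (valP w). Qed.

Definition top_block w := sval (cid (peak_block HClS_ind (admissible_peak w))).
Definition block_par w := (top_block w).1.
Definition block_proj w := (top_block w).2.1.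
Definition block_incl w := (top_block w).2.2.

Arguments block_par : clear implicits.
Arguments block_proj : clear implicits.
Arguments block_incl : clear implicits.

Lemma top_blockP w : [/\ forall j x, block_proj w j (block_incl w j x) = x,
  forall j k x, j != k -> block_proj w k (block_incl w j x) = 0,
  forall s, s = \sum_j block_incl w j (block_proj w j s),
  forall j d s, sm_gr d s -> sm_gr (d (+) block_par w j) (block_proj w j s)
  & forall j d x, sm_gr d x -> sm_gr (d (+) block_par w j) (block_incl w j x)].
Proof.
rewrite /block_proj /block_incl /block_par /top_block; case: cid => -[eps [pi mu]].
by case.
Qed.

Lemma admissible_compat w : exists E, compat (@desc n alpha) (comp_of_set (val w)) E.
Proof.
apply/existsP; rewrite exists_compat; last exact: admissible_peak.
by case/andP: (valP w).
Qed.

Definition top_bits w : bits n := sval (cid (admissible_compat w)).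
Lemma top_bitsP w : compat (@desc n alpha) (comp_of_set (val w)) (top_bits w).
Proof. exact: svalP (cid (admissible_compat w)). Qed.

Definition top_gen w : S (val w) := witness e (comp_of_set (val w)) (top_bits w).
Definition top_gen_par w : bool := odd (size (enum_bits (top_bits w))).
Definition top_map w : {linear N -> S (val w)} := cover_lift s (top_gen w).

Lemma top_map_gen w : top_map w n0 = top_gen w.
Proof. by apply: cover_lift_gen; apply: witness_idem. Qed.

Lemma top_map_gr w d z : sm_gr d z -> sm_gr (d (+) top_gen_par w) (top_map w z).
Proof.
by apply: (cover_lift_gr sp); [apply: witness_idem | apply: witness_gr].
Qed.

Definition top_idx := {w : admissible & 'I_(2 ^ peak_exp (val w))}.
Implicit Types (u : top_idx).
Definition top_ix w (j : 'I_(2 ^ peak_exp (val w))) : top_idx := Tagged _ j.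

(** The shift that makes [top_proj u] even: the parity of the block plus that of the generator of
    S_P. *)
Definition top_par u : bool := block_par (tag u) (tagged u) (+) top_gen_par (tag u).
Definition top_summand u : supermod A := parity_if (top_par u) (HClS (val (tag u))).
Definition top_proj u : {linear N -> top_summand u} :=
  pin (top_par u) (HClS (val (tag u))) \o block_proj (tag u) (tagged u) \o top_map (tag u).

Lemma top_proj_even u : even_map (top_proj u).
Proof.
have [_ _ _ h4 _] := top_blockP (tag u).
move=> d z /top_map_gr /(h4 (tagged u)) /(@pin_gr _ (top_par u)) h.
move: h.
suff -> : d (+) top_gen_par (tag u) (+) block_par (tag u) (tagged u) (+) top_par u = d by [].
by rewrite /top_par; case: (d); case: top_gen_par; case: block_par.
Qed.

Lemma top_summand_simple u : super_simple (top_summand u).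
Proof. by apply/simple_parity_if/HClS_simple/admissible_peak. Qed.

(** A proper image would satisfy a relation [theta]. The blocks of the other S_P contribute nothing
    to it, as Hom vanishes, so it yields an endomorphism of one S_P that kills the witness without
    being zero. *)
Lemma top_proj_surj : surj (dmap top_proj).
Proof.
apply: contrapT => /(joint_surj top_summand_simple top_proj_even)[[w j0]].
rewrite -[existT _ w j0]/(top_ix j0) => -[theta [th0 th1]].
have [h1 h2 h3 _ _] := top_blockP w.
pose mu : {linear top_summand (top_ix j0) -> S (val w)} :=
  block_incl w j0 \o pout (top_par (top_ix j0)) (HClS (val w)).
have mu_inj x : mu x = 0 -> x = 0.
  move=> mx; rewrite -[x](@poutK _ (top_par (top_ix j0)) (HClS (val w))).
  by rewrite -[pout _ _ x](h1 j0) [block_incl _ _ _]mx !linear0.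
(* The part of [theta] seen by block j' of S_w'; followed by the injection [mu] it becomes a map
   from S_w' to S_w. *)
pose a w' j' : {linear S (val w') -> top_summand (top_ix j0)} :=
  theta \o dinj (top_ix j') \o pin (top_par (top_ix j')) _ \o block_proj w' j'.
have a0 w' j' x : w' != w -> a w' j' x = 0.
  move=> ww'; apply: mu_inj.
  exact: (@ind_simple_hom0 K n (val w') (val w) (admissible_peak _) (admissible_peak _) ww'
    (mu \o a w' j') x).
have aL : linear (fun x => \sum_j a w j x).
  move=> c x y; rewrite scaler_sumr -big_split; apply: eq_bigr => j _.
  by rewrite linearP.
pose th : {linear S (val w) -> top_summand (top_ix j0)} := mklin aL.
have thgen : th (top_gen w) = 0.
  rewrite mklinE; have := th0 n0; rewrite [dmap _ _]dsumE linear_sum.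
  rewrite (eq_bigr (fun u => a (tag u) (tagged u) (top_gen (tag u)))); last first.
    by case=> w' j' _; rewrite dproj_dmap /a /top_proj /= top_map_gen.
  rewrite -(@sig_big_dep _ _ _ _ _ xpredT (fun _ => xpredT)
    (fun w' j' => a w' j' (top_gen w'))) /= (bigD1 w) //= [X in _ + X]big1 ?addr0 //.
  by move=> w' ww'; apply: big1 => j' _; apply: a0.
have [[x xn0] _] := top_summand_simple (top_ix j0).
move/eqP: xn0; apply.
have kill y : mu (th y) = 0.
  apply: (@witness_kill K n _ e eP (comp_of_set (val w)) _ (top_bitsP w) (mu \o th)).
  by rewrite -[LHS]/(mu (th (top_gen w))) thgen linear0.
have := mu_inj _ (kill (block_incl w j0 (pout (top_par (top_ix j0)) _ x))).
rewrite mklinE (bigD1 j0) //= big1 => [|j jj0].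
  by rewrite addr0 /a /= h1 poutK th1.
by rewrite /a /= h2 1?eq_sym // !linear0.
Qed.

(** Otherwise a simple quotient Y of Ind(P_alpha) kills U. Embedded in some S_P, the image of n0 is
    a nonzero element of e S_P, so P is admissible and, by [witness_gen], the map to Y factors
    through [top_map]. But n0 and an element of U have the same image there. *)
Lemma top_proj_essential (U : N -> Prop) : sub_supermodule U ->
  (forall z, exists2 y, U y & dmap top_proj y = dmap top_proj z) -> forall z, U z.
Proof.
move=> Us hU; have Un0 : U n0; last first.
  have [_ _ UZ _] := Us.
  by move=> z; have [a ->] := ind_genP sp z; apply: UZ.
apply: contrapT => Un.
have [Y [q [Ys qe qs qU]]] := exists_simple_quotient (ind_genP sp) Us Un.
have qn0 : q n0 != 0.
  apply/eqP => q0; have [[y /eqP y0] _] := Ys; apply: y0.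
  have [z <-] := qs y; have [a ->] := ind_genP sp z.
  by rewrite linearZZ q0 scaler0.
have [P hP [g g_inj]] := simple_embedding HClS_simple HClS_ind Ys.
pose x := g (q n0).
have ex : eA *: x = x by rewrite /x -!linearZZ ind_gen_idem.
have xn0 : x <> 0 by move=> /g_inj /eqP; rewrite (negPf qn0).
have [hc|hc] := boolP [exists E, compat (@desc n alpha) (comp_of_set P) E]; last first.
  exact: xn0 (no_witness ee eP hc ex).
have okP : is_peak_set P && (P \subset descents_symdiff n alpha).
  by rewrite hP -exists_compat.
pose w : admissible := exist _ P okP.
have [psi psiE] := @witness_gen K n _ e ee eP (comp_of_set P) _ (top_bitsP w) x ex.
have gE z : g (q z) = psi (top_map w z).
  have [a ->] := ind_genP sp z.
  by rewrite !linearZZ top_map_gen -/x /top_gen psiE.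
have [y Uy yE] := hU n0.
have [_ _ h3 _ _] := top_blockP w.
have on0 : top_map w (n0 - y) = 0.
  rewrite [LHS]h3 big1 // => j _.
  have /(congr1 (dproj (top_ix j))) := yE.
  rewrite !dproj_dmap /top_proj /= => /(can_inj (@pinK _ _ _)) E.
  by rewrite !linearB /= E subrr.
have : g (q (n0 - y)) = 0 by rewrite gE on0 linear0.
by rewrite linearB /= (qU _ Uy) subr0.
Qed.

Variable HClP : {set 'I_n.+1} -> supermod (hecke_clifford K n).
Hypothesis HClP_cover : forall P : {set 'I_n.+1}, is_peak_set P ->
  super_projective_cover (HClP P) (HClS P).

(** Projective covers of the summands lift to a map T onto Ind(P_alpha); a section R of T is then
    shown to be bijective. *)
Lemma ind_cover_decomposition :
  superiso_dsum N (fun u : top_idx => HClP (val (tag u))).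
Proof.
have cov u := cover_parity_if (top_par u) (HClP_cover (admissible_peak (tag u)))
  (HClS_simple (admissible_peak (tag u))).
pose F u := parity_if (top_par u) (HClP (val (tag u))).
have /cid[q qP] : exists q : forall u, {linear F u -> top_summand u},
    forall u, [/\ even_map (q u), surj (q u) & essential_gen (q u)].
  exists (fun u => sval (cid (cov u).2)) => u; exact: svalP (cid (cov u).2).
have phi_even : even_map (dmap top_proj).
  by move=> d z hz; apply: dsum_gr_proj => u; rewrite dproj_dmap; apply: top_proj_even.
have Nfg : finitely_generated N.
  exists 1%N, (fun=> n0) => x; have [a ->] := ind_genP sp x.
  by exists (fun=> a); rewrite big_ord1.
have Xfg : finitely_generated (dsum top_summand).
  exists 1%N, (fun=> dmap top_proj n0) => x; have [z <-] := top_proj_surj x.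
  have [a ->] := ind_genP sp z.
  by exists (fun=> a); rewrite big_ord1 linearZZ.
have /cid[t tP] : exists t : forall u, {linear F u -> N}, forall u,
    even_map (t u) /\ forall x, dmap top_proj (t u x) = dinj u (q u x).
  have ex u : exists t : {linear F u -> N},
      even_map t /\ forall x, dmap top_proj (t x) = dinj u (q u x).
    have [qe _ _] := qP u; have [[_ Fproj] _] := cov u.
    have de : even_map (dinj u \o q u) by move=> d x hx; apply/dinj_even/qe.
    have [t te tE] := Fproj N (dsum top_summand) (dmap top_proj) (dinj u \o q u) Nfg Xfg
      phi_even de top_proj_surj.
    by exists t.
  by exists (fun u => sval (cid (ex u))) => u; exact: svalP (cid (ex u)).
pose T : {linear dsum F -> N} := dcomap t.
have Te : even_map T.
  move=> d x hx; rewrite /T mklinE; apply: big_ind => [|y z|u _].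
  - exact: sm_gr0.
  - exact: sm_grD.
  by have [te _] := tP u; apply/te/dproj_even.
have phiT x u : dproj u (dmap top_proj (T x)) = q u (dproj u x).
  have Td v y : dproj u (dmap top_proj (T (dinj v y))) = dproj u (dinj v (q v y)).
    by have [_ <-] := tP v; rewrite /T dcomap_dinj.
  rewrite {1}[x]dsumE [T _]linear_sum [dmap _ _]linear_sum [LHS]linear_sum.
  rewrite (bigD1 u) //= Td dproj_dinj big1 ?addr0 // => v vu.
  by rewrite Td dproj_dinj0.
have Tsurj : surj T.
  apply: top_proj_essential; first exact: sub_supermodule_im.
  move=> z; have ex u : exists x, q u x = dproj u (dmap top_proj z).
    by have [_ qs _] := qP u; apply: qs.
  pose x u := sval (cid (ex u)).
  have xE u : q u (x u) = dproj u (dmap top_proj z) := svalP (cid (ex u)).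
  exists (T (\sum_u dinj u (x u))); first by exists (\sum_u dinj u (x u)).
  apply: dsum_ext => u; rewrite phiT linear_sum (bigD1 u) //= dproj_dinj big1.
    by rewrite addr0 xE.
  by move=> v vu; rewrite dproj_dinj0.
have [z0 Tz0] := Tsurj n0.
(* A section of T amounts to an e-fixed preimage of n0. The even part of any preimage is again one,
   as n0 is even, and applying e makes it fixed. *)
have [z1 [_ [z1e _ _ Tz1 _]]] := even_map_split Te (ind_gen_even p)
  (sm_gr0 N true) (etrans Tz0 (esym (addr0 _))).
pose z := eA *: z1.
have ez : eA *: z = z by rewrite /z scalerA -rmorphM ee.
have ze : sm_gr false z.
  by rewrite -[false]addbF; apply: sm_act => //; apply: hecke_incl_even.
pose R : {linear N -> dsum F} := cover_lift s z.
have TR x : T (R x) = x.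
  have [a ->] := ind_genP sp x; rewrite !linearZZ /R cover_lift_gen //.
  by rewrite /z linearZZ Tz1 ind_gen_idem.
exists top_par, R => [d x hx|]; first by rewrite -[d]addbF; apply: (cover_lift_gr sp).
apply: bijective_linear => [x Rx|x]; first by rewrite -[x]TR Rx linear0.
(* The image of R exhausts the top: R (T x) and x have the same T-image, hence the same image under
   each q u. *)
apply: (@dsum_essential _ _ _ _ q (fun y => exists x, R x = y)) x => [u|u|u|u||x].
- by case: (qP u).
- by case: (qP u).
- exact: top_summand_simple.
- by case: (qP u).
- by apply: sub_supermodule_im => d x hx; rewrite -[d]addbF; apply: (cover_lift_gr sp).
by exists (R (T x)); [exists (T x) | move=> u; rewrite -!phiT TR].
Qed.

End Top.

Theorem corollary4p1p2 (K : closedFieldType) (charK : [pchar K] =i pred0) (n : nat)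
    (HClS HClP : {set 'I_n.+1} -> supermod (hecke_clifford K n))
    (HClS_simple : forall P : {set 'I_n.+1}, is_peak_set P -> super_simple (HClS P))
    (HClS_ind : forall beta : seq nat, is_comp n beta ->
       superiso_dsum (Ind (hecke_simple K n beta))
         (fun _ : 'I_(2 ^ peak_exp (peaks n beta)) => HClS (peaks n beta)))
    (HClP_cover : forall P : {set 'I_n.+1}, is_peak_set P ->
       super_projective_cover (HClP P) (HClS P))
    (alpha : seq nat) (alpha_comp : is_comp n alpha)
    (Palpha : lmodType (hecke K n))
    (Palpha_cover : projective_cover Palpha (hecke_simple K n alpha)) :
  superiso_dsum (Ind Palpha)
    (fun u : {P : {P : {set 'I_n.+1} |
                    is_peak_set P && (P \subset descents_symdiff n alpha)}
              & 'I_(2 ^ peak_exp (val P))} => HClP (val (tag u))).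
Proof.
have [p [s [sp ee eP]]] := cover_idempotent Palpha_cover.
exact: (ind_cover_decomposition HClS_simple HClS_ind sp ee eP HClP_cover).
Qed.
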